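(* For a Banach lattice $E$, the following are equivalent: (a) $E$ has the dual positive Schur property. (b) Every absolutely weak$^*$ null sequence in $E^*$ is norm null. (c) $E$ has the positive Grothendieck property and every sequentially absolutely weak$^*$ compact subset of $E^*$ is contained in the closed convex hull of an absolutely weak$^*$ null sequence in $E^*$.
   Context: Banach lattices are real; $E^*$ denotes the topological dual of $E$. The absolute weak$^*$ topology $|\sigma|(E^*,E)$ on $E^*$ is the locally convex-solid topology generated by the lattice seminorms $q_x(x^* ) = |x^*|(|x|)$, $x^* \in E^*$, where $x$ ranges over $E$. A sequence in $E^*$ is absolutely weak$^*$ null if it converges to $0$ in $|\sigma|(E^*,E)$. A subset $K$ of $E^*$ is sequentially absolutely weak$^*$ compact if every sequence in $K$ has a subsequence converging in $|\sigma|(E^*,E)$ to an element of $K$. The closed convex hull of a set is the norm closure of its convex hull; the closed convex hull of a sequence is that of the set of its terms. A Banach lattice $E$ has the dual positive Schur property (respectively, the positive Grothendieck property) if every weak$^*$ null sequence of positive elements of $E^*$ is norm null (respectively, weakly null, i.e. null for $\sigma(E^*,E^{**})$). *)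

(* Defs.v *)
From HB Require Import structures.
From mathcomp Require Import all_boot all_order all_algebra.
From mathcomp Require Import all_classical all_reals all_analysis.
From mathcomp Require Import ring lra.
Import Order.TTheory GRing.Theory Num.Theory.
Import numFieldNormedType.Exports.

Set Implicit Arguments.
Unset Strict Implicit.
Unset Printing Implicit Defensive.

Local Open Scope classical_set_scope.
Local Open Scope ring_scope.

Reserved Notation "x ⊑ y" (at level 70, no associativity).
Reserved Notation "x ⊔ y" (at level 50, left associativity).
Reserved Notation "x ⊓ y" (at level 48, left associativity).

(* A vector lattice. The order is a field of the mixin, and not inherited from
   Order.Lattice, because Hierarchy Builder cannot join Order.Lattice with
   Zmodule (or Order.POrder with NormedZmodule): Num.RealDomain and
   Num.NumDomain, declared earlier, would have to inherit from the join. *)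
HB.mixin Record isRieszSpace (R : numDomainType) E of GRing.Lmodule R E := {
  rle : E -> E -> Prop ;
  rsup : E -> E -> E ;
  rinf : E -> E -> E ;
  rle_refl : forall x, rle x x ;
  rle_anti : forall x y, rle x y -> rle y x -> x = y ;
  rle_trans : forall y x z, rle x y -> rle y z -> rle x z ;
  rleD2r : forall z x y, rle x y -> rle (x + z) (y + z) ;
  rleZ_ge0 : forall (a : R) x, 0 <= a -> rle 0 x -> rle 0 (a *: x) ;
  rsup_le : forall x y z, rle (rsup x y) z <-> rle x z /\ rle y z ;
  le_rinf : forall x y z, rle z (rinf x y) <-> rle z x /\ rle z y
}.

#[short(type="rieszSpaceType")]
HB.structure Definition RieszSpace (R : numDomainType) :=
  { E of GRing.Lmodule R E & isRieszSpace R E }.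

Notation "x ⊑ y" := (rle x y) : ring_scope.
Notation "x ⊔ y" := (rsup x y) : ring_scope.
Notation "x ⊓ y" := (rinf x y) : ring_scope.

Definition modulus (R : numDomainType) (E : rieszSpaceType R) (x : E) : E :=
  x ⊔ - x.

HB.mixin Record isBanachLattice (R : realType) E
    of CompleteNormedModule R E & RieszSpace R E := {
  lattice_norm : forall x y : E, modulus x ⊑ modulus y -> `|x| <= `|y|
}.

#[short(type="banachLatticeType")]
HB.structure Definition BanachLattice (R : realType) :=
  { E of CompleteNormedModule R E & RieszSpace R E & isBanachLattice R E }.

Section RieszTheory.
Context {R : realType} {E : rieszSpaceType R}.
Implicit Types x y z : E.

Lemma rsub_ge0 x y : x ⊑ y -> 0 ⊑ y - x.
Proof. by move=> /(rleD2r (- x)); rewrite subrr. Qed.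

Lemma rleD x y x' y' : x ⊑ y -> x' ⊑ y' -> x + x' ⊑ y + y'.
Proof.
move=> /(rleD2r x') h /(rleD2r y); rewrite ![_ + y]addrC => h'.
exact: rle_trans h h'.
Qed.

Lemma rleD2 z x y : x + z ⊑ y + z -> x ⊑ y.
Proof. by move=> /(rleD2r (- z)); rewrite !addrK. Qed.

Lemma rleN2 x y : x ⊑ y -> - y ⊑ - x.
Proof.
by move=> /(rleD2r (- x - y)); rewrite addrA subrr add0r addrCA subrr addr0.
Qed.

Lemma rle_supl x y : x ⊑ x ⊔ y.
Proof. by have /rsup_le[] := rle_refl (x ⊔ y). Qed.

Lemma rle_supr x y : y ⊑ x ⊔ y.
Proof. by have /rsup_le[] := rle_refl (x ⊔ y). Qed.

Lemma rinf_lel x y : x ⊓ y ⊑ x.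
Proof. by have /le_rinf[] := rle_refl (x ⊓ y). Qed.

Lemma rinf_ler x y : x ⊓ y ⊑ y.
Proof. by have /le_rinf[] := rle_refl (x ⊓ y). Qed.

Lemma rsupC x y : x ⊔ y = y ⊔ x.
Proof.
by apply: rle_anti; apply/rsup_le; split;
  solve [exact: rle_supl|exact: rle_supr].
Qed.

Lemma rsupD z x y : (x ⊔ y) + z = (x + z) ⊔ (y + z).
Proof.
apply: rle_anti; last first.
  by apply/rsup_le; split; apply: rleD2r; [exact: rle_supl|exact: rle_supr].
apply: (@rleD2 (- z)); rewrite addrK; apply/rsup_le; split.
  by rewrite -[X in X ⊑ _](addrK z x); apply: rleD2r; exact: rle_supl.
by rewrite -[X in X ⊑ _](addrK z y); apply: rleD2r; exact: rle_supr.
Qed.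

Definition rpos x : E := x ⊔ 0.

Lemma rpos_ge0 x : 0 ⊑ rpos x. Proof. exact: rle_supr. Qed.

Lemma rposB x : rpos x - rpos (- x) = x.
Proof.
suff <- : rpos x - x = rpos (- x) by rewrite opprB addrCA subrr addr0.
by rewrite /rpos rsupD subrr add0r rsupC.
Qed.

Lemma modulus_ge0 x : 0 ⊑ modulus x.
Proof.
have : 0 ⊑ 2^-1 *: (modulus x + modulus x).
  apply: rleZ_ge0; first by rewrite invr_ge0.
  by rewrite -(subrr x); apply: rleD; [exact: rle_supl|exact: rle_supr].
by rewrite -mulr2n -[X in _ *: X]scaler_nat scalerA mulVf// scale1r.
Qed.

Lemma modulus_id x : 0 ⊑ x -> modulus x = x.
Proof.
move=> x0; apply: rle_anti; last exact: rle_supl.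
apply/rsup_le; split; first exact: rle_refl.
suff nx0 : - x ⊑ 0 by exact: rle_trans nx0 x0.
by rewrite -oppr0; exact: rleN2.
Qed.

Lemma rpos_le_modulus x : rpos x ⊑ modulus x.
Proof. by apply/rsup_le; split; [exact: rle_supl|exact: modulus_ge0]. Qed.

Lemma riesz_decomposition y (a b : E) :
  0 ⊑ y -> 0 ⊑ a -> 0 ⊑ b -> y ⊑ a + b ->
  [/\ 0 ⊑ y ⊓ a, y ⊓ a ⊑ a, 0 ⊑ y - y ⊓ a & y - y ⊓ a ⊑ b].
Proof.
move=> y0 a0 b0 yab; split.
- exact/le_rinf.
- exact: rinf_ler.
- by apply: rsub_ge0; exact: rinf_lel.
apply: (@rleD2 (y ⊓ a - b)); rewrite addrA subrK addrCA subrr addr0.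
apply/le_rinf; split.
  apply: (@rleD2 b); rewrite subrK -[X in X ⊑ _]addr0.
  by apply: rleD => //; exact: rle_refl.
by apply: (@rleD2 b); rewrite subrK.
Qed.

End RieszTheory.

Section BanachLatticeTheory.
Context {R : realType} {E : banachLatticeType R}.
Implicit Types x y : E.

Lemma norm_rle x y : 0 ⊑ x -> x ⊑ y -> `|x| <= `|y|.
Proof.
move=> x0 xy; apply: lattice_norm.
by rewrite !modulus_id//; exact: rle_trans xy.
Qed.

Lemma norm_modulus x : `|modulus x| = `|x|.
Proof.
by apply/eqP; rewrite eq_le; apply/andP; split; apply: lattice_norm;
  rewrite (modulus_id (modulus_ge0 x)); exact: rle_refl.
Qed.

Lemma norm_rpos x : `|rpos x| <= `|x|.
Proof.
rewrite -[leRHS]norm_modulus; apply: norm_rle; first exact: rpos_ge0.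
exact: rpos_le_modulus.
Qed.

End BanachLatticeTheory.

Section Dual.
Context {R : realType} {V : normedModType R}.

Definition dual_pred : {pred V -> R^o} :=
  fun f => `[< linear f /\ continuous f >].

Record dual := Dual { dual_fun :> V -> R^o ; _ : dual_fun \in dual_pred }.

HB.instance Definition _ := [isSub for dual_fun].
HB.instance Definition _ := [Choice of dual by <:].

Lemma dual_pred_submod : submod_closed dual_pred.
Proof.
split=> [|a f g /asboolP[lf cf] /asboolP[lg cg]]; apply/asboolP.
  split=> [a x y|]; last exact: cst_continuous.
  rewrite [LHS](_ : _ = 0 :> R^o)// [X in _ + X](_ : _ = 0 :> R^o)//.
  by rewrite [X in _ *: X](_ : _ = 0 :> R^o)// scaler0 addr0.
split=> [b x y|x].
  rewrite [LHS](_ : _ = a *: f (b *: x + y) + g (b *: x + y))//.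
  rewrite [RHS](_ : _ = b *: (a *: f x + g x) + (a *: f y + g y))//.
  by rewrite lf lg !scalerDr !scalerA (mulrC a b) addrACA.
apply: (@cvgD _ _ _ _ _ (fun y => a *: f y) g); last exact: cg.
by apply: cvgZl_tmp; exact: cf.
Qed.

HB.instance Definition _ :=
  GRing.isSubmodClosed.Build R (V -> R^o) dual_pred dual_pred_submod.
HB.instance Definition _ := [SubChoice_isSubLmodule of dual by <:].

Lemma dual_linear (f : dual) : linear f.
Proof. by case: f => f /= /asboolP[]. Qed.

HB.instance Definition _ (f : dual) :=
  GRing.isLinear.Build R V R^o *:%R f (dual_linear f).

Lemma dual_continuous (f : dual) : continuous f.
Proof. by case: f => f /= /asboolP[]. Qed.

Definition op_norm (f : dual) : R :=
  sup [set `|f x| | x in [set x | `|x| <= 1]].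

Let op_norm_has_sup (f : dual) :
  has_sup [set `|f x| | x in [set x | `|x| <= 1]].
Proof.
split; first by exists `|f 0|, 0 => //=; rewrite normr0.
have /linear_bounded_continuous/linear_boundedP/pinfty_ex_gt0[M M0 fM] :=
  @dual_continuous f.
exists M => _ [x /= x1 <-]; apply: (le_trans (fM x)).
by rewrite -[leRHS]mulr1 ler_wpM2l// ltW.
Qed.

Implicit Types f g : dual.

Lemma op_norm_ge0 f : 0 <= op_norm f.
Proof.
apply: ub_le_sup; first by have [] := op_norm_has_sup f.
by exists 0; rewrite /= ?normr0// linear0 normr0.
Qed.

Lemma le_op_norm f x : `|f x| <= op_norm f * `|x|.
Proof.
have [->|x0] := eqVneq x 0; first by rewrite linear0 !normr0 mulr0.
have nx : 0 < `|x| by rewrite normr_gt0.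
rewrite -ler_pdivrMr//; apply: ub_le_sup; first by have [] := op_norm_has_sup f.
exists (`|x|^-1 *: x).
  by rewrite /= normrZ normfV normr_id mulVf// gt_eqF.
by rewrite linearZ/= normrZ normfV normr_id mulrC.
Qed.

Lemma op_norm_le f M : (forall x, `|x| <= 1 -> `|f x| <= M) -> op_norm f <= M.
Proof.
move=> fM; apply: ge_sup; first by have [] := op_norm_has_sup f.
by move=> _ [x x1 <-]; exact: fM.
Qed.

Lemma op_normD f g : op_norm (f + g) <= op_norm f + op_norm g.
Proof.
apply: op_norm_le => x x1; apply: (le_trans (ler_normD _ _)).
by apply: lerD; apply: (le_trans (le_op_norm _ _));
  rewrite -[leRHS]mulr1 ler_wpM2l// op_norm_ge0.
Qed.

Lemma op_normZ a f : op_norm (a *: f) = `|a| * op_norm f.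
Proof.
have le b g : op_norm (b *: g) <= `|b| * op_norm g.
  apply: op_norm_le => x x1; rewrite [X in `|X|](_ : _ = b *: g x)// normrZ.
  rewrite ler_wpM2l//; apply: (le_trans (le_op_norm _ _)).
  by rewrite -[leRHS]mulr1 ler_wpM2l// op_norm_ge0.
apply/eqP; rewrite eq_le le /=.
have [->|a0] := eqVneq a 0; first by rewrite normr0 mul0r op_norm_ge0.
rewrite -ler_pdivlMl ?normr_gt0// -normfV.
by rewrite -[in leLHS](scale1r f) -(mulVf a0) -scalerA le.
Qed.

Lemma op_norm0_eq0 f : op_norm f = 0 -> f = 0.
Proof.
move=> f0; apply/val_inj/funext => x /=; apply/eqP; rewrite -normr_le0.
by apply: (le_trans (le_op_norm f x)); rewrite f0 mul0r.
Qed.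

HB.instance Definition _ :=
  Lmodule_isNormed.Build R dual op_normD op_normZ op_norm0_eq0.

Lemma dual_normE f : `|f| = op_norm f. Proof. by []. Qed.

End Dual.
Arguments dual {R} V.

Section DualLattice.
Context {R : realType} {E : banachLatticeType R}.
Implicit Types f g : dual E.

Definition dual_le f g : Prop := forall x : E, 0 ⊑ x -> f x <= g x.

Section Positive_part.
Variable f : dual E.

(* Riesz-Kantorovich formula for the positive part of f on the positive cone *)
Definition pos_cone (x : E) : R :=
  sup [set f y | y in [set y | 0 ⊑ y /\ y ⊑ x]].

Lemma pos_cone_ub x y : 0 ⊑ y -> y ⊑ x -> f y <= pos_cone x.
Proof.
move=> y0 yx; apply: ub_le_sup; last by exists y.
exists (op_norm f * `|x|) => _ [z [z0 zx] <-].
apply: (le_trans (ler_norm _)); apply: (le_trans (le_op_norm _ _)).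
by rewrite ler_wpM2l ?op_norm_ge0// norm_rle.
Qed.

Lemma pos_cone_lub x c : 0 ⊑ x ->
  (forall y, 0 ⊑ y -> y ⊑ x -> f y <= c) -> pos_cone x <= c.
Proof.
move=> x0 fc; apply: ge_sup; last by move=> _ [y [y0 yx] <-]; exact: fc.
by exists (f x), x => //; split=> //; exact: rle_refl.
Qed.

Lemma pos_cone_ge0 x : 0 ⊑ x -> 0 <= pos_cone x.
Proof.
by move=> x0; rewrite -(linear0 f); apply: pos_cone_ub => //; exact: rle_refl.
Qed.

Lemma pos_cone_norm x : 0 ⊑ x -> pos_cone x <= op_norm f * `|x|.
Proof.
move=> x0; apply: pos_cone_lub => // y y0 yx.
apply: (le_trans (ler_norm _)); apply: (le_trans (le_op_norm _ _)).
by rewrite ler_wpM2l ?op_norm_ge0// norm_rle.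
Qed.

Lemma pos_coneD a b : 0 ⊑ a -> 0 ⊑ b ->
  pos_cone (a + b) = pos_cone a + pos_cone b.
Proof.
move=> a0 b0; have ab0 : 0 ⊑ a + b by rewrite -[0]addr0; exact: rleD.
apply/eqP; rewrite eq_le; apply/andP; split.
  apply: pos_cone_lub => // y y0 yab.
  have [h1 h2 h3 h4] := riesz_decomposition y0 a0 b0 yab.
  have -> : f y = f (y ⊓ a) + f (y - y ⊓ a) by rewrite -linearD addrC subrK.
  by apply: lerD; exact: pos_cone_ub.
rewrite -lerBrDr; apply: pos_cone_lub => // y y0 ya.
rewrite lerBrDr addrC -lerBrDr; apply: pos_cone_lub => // z z0 zb.
rewrite lerBrDr addrC -linearD; apply: pos_cone_ub; last exact: rleD.
by rewrite -[0]addr0; exact: rleD.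
Qed.

Lemma pos_cone0 : pos_cone 0 = 0.
Proof.
apply/eqP; rewrite eq_le pos_cone_ge0 ?andbT; last exact: rle_refl.
apply: pos_cone_lub; first exact: rle_refl.
by move=> y y0 y0'; rewrite (rle_anti _ _ y0' y0) linear0.
Qed.

Lemma pos_coneZ (a : R) x : 0 <= a -> 0 ⊑ x ->
  pos_cone (a *: x) = a * pos_cone x.
Proof.
have le (b : R) y : 0 < b -> 0 ⊑ y -> pos_cone (b *: y) <= b * pos_cone y.
  move=> b0 y0; apply: pos_cone_lub; first by apply: rleZ_ge0 => //; exact: ltW.
  move=> z z0 zby; rewrite -ler_pdivrMl//.
  have -> : b^-1 * f z = f (b^-1 *: z) by rewrite linearZ.
  apply: pos_cone_ub.
    by apply: rleZ_ge0 => //; rewrite invr_ge0 ltW.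
  apply: (@rleD2 _ _ (- (b^-1 *: z))); rewrite subrr.
  have -> : y - b^-1 *: z = b^-1 *: (b *: y - z).
    by rewrite scalerBr scalerA mulVf ?gt_eqF// scale1r.
  by apply: rleZ_ge0; [rewrite invr_ge0 ltW|exact: rsub_ge0].
rewrite le_eqVlt => /predU1P[<-|a0] x0.
  by rewrite scale0r mul0r pos_cone0.
apply/eqP; rewrite eq_le le//= -ler_pdivlMl//.
rewrite -[in leLHS](scale1r x) -(mulVf (lt0r_neq0 a0)) -scalerA le ?invr_gt0//.
by apply: rleZ_ge0 => //; exact: ltW.
Qed.

Definition pos_fun (x : E) : R^o := pos_cone (rpos x) - pos_cone (rpos (- x)).

Lemma pos_funB a b : 0 ⊑ a -> 0 ⊑ b ->
  pos_fun (a - b) = pos_cone a - pos_cone b.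
Proof.
move=> a0 b0.
have : rpos (a - b) + b = a + rpos (- (a - b)).
  have /eqP := rposB (a - b); rewrite subr_eq => /eqP e.
  by rewrite {1}e addrAC subrK.
move=> /(congr1 pos_cone); rewrite !pos_coneD//; try exact: rpos_ge0.
by rewrite /pos_fun => h; lra.
Qed.

Lemma pos_fun_id x : 0 ⊑ x -> pos_fun x = pos_cone x.
Proof.
move=> x0; rewrite -[in LHS](subr0 x) pos_funB ?pos_cone0 ?subr0//.
exact: rle_refl.
Qed.

Lemma pos_fun_linear : linear pos_fun.
Proof.
move=> k x y; set xp := rpos x; set xn := rpos (- x).
set yp := rpos y; set yn := rpos (- y).
have [xp0 xn0 yp0 yn0] : [/\ 0 ⊑ xp, 0 ⊑ xn, 0 ⊑ yp & 0 ⊑ yn].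
  by split; exact: rpos_ge0.
have [k0|k0] := leP 0 k.
  have -> : k *: x + y = (k *: xp + yp) - (k *: xn + yn).
    by rewrite opprD addrACA -scalerBr !rposB.
  have h1 := rleZ_ge0 _ _ k0 xp0; have h2 := rleZ_ge0 _ _ k0 xn0.
  rewrite pos_funB; [|by rewrite -[0]addr0; exact: rleD..].
  by rewrite !pos_coneD// !pos_coneZ// /pos_fun /GRing.scale/=; ring.
have nk0 : 0 <= - k by rewrite oppr_ge0 ltW.
have -> : k *: x + y = (- k *: xn + yp) - (- k *: xp + yn).
  by rewrite opprD addrACA -scalerBr scaleNr -scalerN opprB !rposB.
have h1 := rleZ_ge0 _ _ nk0 xp0; have h2 := rleZ_ge0 _ _ nk0 xn0.
rewrite pos_funB; [|by rewrite -[0]addr0; exact: rleD..].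
by rewrite !pos_coneD// !pos_coneZ// /pos_fun /GRing.scale/=; ring.
Qed.

HB.instance Definition _ :=
  GRing.isLinear.Build R E R^o *:%R pos_fun pos_fun_linear.

Lemma pos_fun_dual : pos_fun \in dual_pred.
Proof.
apply/asboolP; split; first exact: pos_fun_linear.
apply: bounded_linear_continuous; apply/linear_boundedP.
exists (op_norm f + op_norm f); split; first exact: num_real.
move=> r /ltW fr x /=; apply: (le_trans (ler_normB _ _)).
rewrite !ger0_norm ?pos_cone_ge0//; try exact: rpos_ge0.
have le_pos z : pos_cone (rpos z) <= op_norm f * `|z|.
  apply: (le_trans (pos_cone_norm (rpos_ge0 z))).
  by rewrite ler_wpM2l ?op_norm_ge0// norm_rpos.
apply: (le_trans (lerD (le_pos _) (le_pos _))); rewrite normrN -mulrDl.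
by rewrite ler_wpM2r.
Qed.

Definition dual_pos : dual E := Dual pos_fun_dual.

Lemma dual_posP g : dual_le dual_pos g <-> dual_le f g /\ dual_le 0 g.
Proof.
split=> [fg|[fg g0] x x0]; last first.
  rewrite /dual_pos/= pos_fun_id//; apply: pos_cone_lub => // y y0 yx.
  apply: (le_trans (fg _ y0)); rewrite -subr_ge0 -linearB.
  by apply: (g0 (x - y)); exact: rsub_ge0.
split=> x x0; apply: le_trans (fg _ x0); rewrite /dual_pos/= pos_fun_id//.
- by apply: pos_cone_ub => //; exact: rle_refl.
- exact: pos_cone_ge0.
Qed.

End Positive_part.

(* locked, so that simplification does not unfold f ⊔ g and modulus f *)
Definition dual_sup f g : dual E := locked (g + dual_pos (f - g)).
Definition dual_inf f g : dual E := locked (- dual_sup (- f) (- g)).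

Lemma dual_le_refl f : dual_le f f. Proof. by []. Qed.

Lemma dual_le_anti f g : dual_le f g -> dual_le g f -> f = g.
Proof.
move=> fg gf; apply/val_inj/funext => x /=.
have eq_pos y : 0 ⊑ y -> f y = g y.
  by move=> y0; apply/eqP; rewrite eq_le fg ?gf.
by rewrite -(rposB x) !linearB/= !eq_pos//; exact: rpos_ge0.
Qed.

Lemma dual_le_trans g f h : dual_le f g -> dual_le g h -> dual_le f h.
Proof. by move=> fg gh x x0; apply: le_trans (fg _ x0) (gh _ x0). Qed.

Lemma dual_leD2r h f g : dual_le f g -> dual_le (f + h) (g + h).
Proof. by move=> fg x x0; apply: lerD => //; exact: fg. Qed.

Lemma dual_leZ_ge0 (a : R) f : 0 <= a -> dual_le 0 f -> dual_le 0 (a *: f).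
Proof. by move=> a0 f0 x x0; apply: mulr_ge0 => //; exact: f0. Qed.

Lemma dual_sup_le f g h :
  dual_le (dual_sup f g) h <-> dual_le f h /\ dual_le g h.
Proof.
rewrite /dual_sup -lock.
have leB k l m : dual_le k (m - l) <-> dual_le (l + k) m.
  by split=> kl x /kl; rewrite -lerBrDl.
apply: (iff_trans (iff_sym (leB _ _ _))); apply: (iff_trans (dual_posP _ _)).
split=> [[/leB + /leB]|[fh gh]]; first by rewrite addrCA subrr !addr0.
by split; apply/leB; rewrite ?addr0// addrCA subrr addr0.
Qed.

Lemma le_dual_inf f g h :
  dual_le h (dual_inf f g) <-> dual_le h f /\ dual_le h g.
Proof.
rewrite /dual_inf -lock.
have leN k l : dual_le k (- l) <-> dual_le l (- k).
  by split=> kl x /kl; rewrite lerNr.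
have leN2 k l : dual_le (- k) (- l) <-> dual_le l k.
  by rewrite leN opprK.
by rewrite leN dual_sup_le !leN2.
Qed.

HB.instance Definition _ := isRieszSpace.Build R (dual E)
  dual_le_refl dual_le_anti dual_le_trans dual_leD2r dual_leZ_ge0
  dual_sup_le le_dual_inf.

End DualLattice.

Section Topologies.
Context {R : realType}.

Lemma cvg_initialP (S : choiceType) (T : topologicalType) (h : S -> T)
    (F : set_system S) (s : S) : Filter F ->
  F --> (s : initial_topology h) <-> h s' @[s' --> F] --> h s.
Proof.
move=> FF; split=> [Fs A /(@initial_continuous _ _ h) /Fs//|Fs A].
rewrite (@nbhsE (initial_topology h)) => -[B [[C oC CB] Bs] BA].
apply: filterS BA _; rewrite -CB; apply: Fs.
by apply: open_nbhs_nbhs; split=> //; rewrite -CB in Bs.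
Qed.

Lemma cvg_initial_ptwsP (S : choiceType) (T : Type) (h : S -> {ptws T -> R^o})
    (F : set_system S) (s : S) : Filter F ->
  F --> (s : initial_topology h) <-> forall t, h s' t @[s' --> F] --> h s t.
Proof.
move=> FF; rewrite cvg_initialP cvg_sup.
split=> Fs t; last by apply/cvg_initialP; exact: Fs.
have /cvg_initialP := Fs t; exact.
Qed.

(* sigma(V^*, V) *)
Definition weak_star (V : normedModType R) : Type :=
  initial_topology (fun f : dual V => (f : {ptws V -> R^o})).

(* sigma(V, V^* ) *)
Definition weak (V : normedModType R) : Type :=
  initial_topology (fun x : V =>
    (fun f : dual V => f x) : {ptws dual V -> R^o}).

(* The topology generated by a family of seminorms: the sets
   [set v | q i (v - w) < e] are a subbase. *)
Definition seminorm_topology (V : zmodType) (I : Type) (q : I -> V -> R) :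
    Type :=
  initial_topology (fun v : V =>
    (fun p : I * V => q p.1 (v - p.2)) : {ptws I * V -> R^o}).

(* |sigma|(E^*, E) *)
Definition abs_weak_star (E : banachLatticeType R) : Type :=
  seminorm_topology (fun (x : E) (f : dual E) => modulus f (modulus x)).

Lemma cvg_weak_starP (V : normedModType R) (F : set_system (dual V))
    (f : dual V) :
  Filter F -> F --> (f : weak_star V) <-> forall x, g x @[g --> F] --> f x.
Proof. by move=> FF; exact: cvg_initial_ptwsP. Qed.

Lemma cvg_weakP (V : normedModType R) (F : set_system V) (x : V) :
  Filter F -> F --> (x : weak V) <-> forall f : dual V, f y @[y --> F] --> f x.
Proof. by move=> FF; exact: cvg_initial_ptwsP. Qed.

Lemma cvg_abs_weak_starP (E : banachLatticeType R) (F : set_system (dual E))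
    (f : dual E) : Filter F ->
  F --> (f : abs_weak_star E) <->
  forall x : E, modulus (g - f) (modulus x) @[g --> F] --> (0 : R^o).
Proof.
move=> FF; rewrite cvg_initial_ptwsP/=; split=> [Ff x|Ff [x h]/=].
  have mod0 : modulus (0 : dual E) = 0 by apply: modulus_id; exact: rle_refl.
  by have := Ff (x, f); rewrite /= subrr mod0.
have tri (a b : dual E) :
    modulus (a + b) (modulus x) <=
    modulus a (modulus x) + modulus b (modulus x).
  suff : modulus (a + b) ⊑ modulus a + modulus b by apply; exact: modulus_ge0.
  apply/rsup_le; split; first by apply: rleD; exact: rle_supl.
  by rewrite opprD; apply: rleD; exact: rle_supr.
have modN (a : dual E) : modulus (- a) = modulus a.
  by rewrite /modulus opprK rsupC.
apply/cvgrPdist_le => e e0.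
have /cvgrPdist_le/(_ e e0) := Ff x; apply: filterS => g.
rewrite sub0r normrN; apply: le_trans; rewrite [leRHS]ger0_norm; last first.
  by apply: (modulus_ge0 (g - f)); exact: modulus_ge0.
rewrite ler_norml; apply/andP; split.
  rewrite lerNl opprB lerBlDr; apply: le_trans (tri _ _).
  by rewrite addrA subrK.
rewrite lerBlDr -(modN (g - f)) opprB; apply: le_trans (tri _ _).
by rewrite addrA subrK.
Qed.

End Topologies.

Definition convex_hull (R : realType) (V : normedModType R) (A : set V) :
  set V :=
  smallest (@convex_set R V) A.

Definition closed_convex_hull (R : realType) (V : normedModType R) (A : set V) :
  set V := closure (convex_hull A).

Section Properties.
Context {R : realType} (E : banachLatticeType R).

Definition abs_weak_star_null (u : nat -> dual E) : Prop :=
  u @ \oo --> ((0 : dual E) : abs_weak_star E).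

Definition seq_abs_weak_star_compact (K : set (dual E)) : Prop :=
  forall u : nat -> dual E, (forall n, K (u n)) ->
  exists (phi : nat -> nat) (f : dual E),
    [/\ increasing_seq phi, K f & (u \o phi) @ \oo --> (f : abs_weak_star E)].

Definition dual_positive_Schur : Prop :=
  forall u : nat -> dual E, (forall n, 0 ⊑ u n) ->
  u @ \oo --> ((0 : dual E) : weak_star E) -> u @ \oo --> (0 : dual E).

Definition positive_Grothendieck : Prop :=
  forall u : nat -> dual E, (forall n, 0 ⊑ u n) ->
  u @ \oo --> ((0 : dual E) : weak_star E) ->
  u @ \oo --> ((0 : dual E) : weak (dual E)).

End Properties.

(* Main.v *)
From HB Require Import structures.
Require Import Defs.
From mathcomp Require Import all_boot all_order all_algebra.
From mathcomp Require Import all_classical all_reals all_analysis.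
From mathcomp Require Import ring lra.
Import Order.TTheory GRing.Theory Num.Theory.
Import numFieldNormedType.Exports.

(** Call a sequence null for a topology when it converges to 0 in it.

    From (a) to (b): if u is absolutely weak* null then the moduli of its terms
    form a positive weak* null sequence, and their norms dominate those of the
    terms.

    From (b) to (c): under (b) a sequentially absolutely weak* compact set is
    norm sequentially compact, so Grothendieck's compactness principle puts it
    in the closed convex hull of a norm null sequence
    (totally_bounded_sub_null_hull).

    From (c) to (a): let u be positive and weak* null with norms above d > 0.
    Let C be the set of sums of the series with terms a_n u_n, where the a_n are
    nonnegative of sum at most 1, and let K be the union over m of the
    intersections of 2^m C with the ball of radius 2^-m.  The set C is
    absolutely weak* compact because a bounded family of coefficients converges
    coordinatewise along a subsequence and u_n(x) tends to 0; the set K is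
    compact because a sequence of K that leaves every layer m is norm null
    (small_multiples_compact).  By (c), K lies in the closed convex hull of an
    absolutely weak* null sequence v.  Choose x_n in the unit ball with
    u_n(x_n) >= d.  A gliding hump along differences of the x_n
    (gliding_hump) gives vectors S_J and indices b_i >= i such that v_k(S_J) is
    bounded by some c, uniformly in k and J, while u_(b_i)(S_J) >= d/4 as soon
    as i < J.  The first bound passes to K.  The positive Grothendieck property
    makes u weakly null, so Mazur's lemma, obtained here from the Hahn-Banach
    theorem, yields for every m a convex combination w of the u_(b_i) of norm at
    most 4^-m.  Then 2^m w is in K, whereas its value at S_J is at least 2^m d/4
    for J large, which is impossible when 2^m d/4 > c.

    The set K has to contain the multiples of the small convex combinations of
    all subsequences of u, because b is chosen after v.  Compare the theorem of
    Dowling, Freeman, Lennard, Odell, Randrianantoanina and Turett, by which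
    only the Schur spaces have the property that every weakly compact set lies
    in the closed convex hull of a weakly null sequence. *)

Local Open Scope classical_set_scope.
Local Open Scope ring_scope.

Set Implicit Arguments.
Unset Strict Implicit.
Unset Printing Implicit Defensive.

(** * Sequences and cluster points *)

Section Sequences.
Context {R : realType}.

Lemma cvg_seqP (V : normedModType R) (u : nat -> V) (l : V) :
  u @ \oo --> l <->
  forall e, 0 < e -> exists N, forall n, (N <= n)%N -> `|l - u n| <= e.
Proof.
split=> [/cvgrPdist_le ul e /ul[N _ uN]|ul]; first by exists N.
by apply/cvgrPdist_le => e /ul[N uN]; exists N.
Qed.

Lemma cvg_seq0P (V : normedModType R) (u : nat -> V) :
  u @ \oo --> (0 : V) <->
  forall e, 0 < e -> exists N, forall n, (N <= n)%N -> `|u n| <= e.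
Proof.
apply: (iff_trans (cvg_seqP u 0)); split=> ul e /ul[N uN]; exists N => n /uN.
- by rewrite sub0r normrN.
- by rewrite sub0r normrN.
Qed.

Lemma extract_increasing (P : nat -> nat -> Prop) :
  (forall i N, exists2 j, (N <= j)%N & P i j) ->
  exists phi, increasing_seq phi /\ forall i, P i (phi i).
Proof.
move=> Pex.
have /choice[h hP] : forall iN : nat * nat, exists j,
    (iN.2 <= j)%N /\ P iN.1 j.
  by move=> [i N]; have [j Nj Pij] := Pex i N; exists j.
pose phi := fix phi i :=
  if i is i'.+1 then h (i, (phi i').+1) else h (0, 0)%N.
exists phi; split; last by case=> [|i]; [have [] := hP (0, 0)%N|
  have [] := hP (i.+1, (phi i).+1)].
by apply/increasing_seqP => i; have [] := hP (i.+1, (phi i).+1).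
Qed.

Lemma increasing_seq_ge (phi : nat -> nat) :
  increasing_seq phi -> forall n, (n <= phi n)%N.
Proof.
move=> /increasing_seqP phiS; elim=> // n IH.
exact: leq_ltn_trans IH (phiS n).
Qed.

Lemma cvg_subseq (T : topologicalType) (u : nat -> T) (l : T) phi :
  increasing_seq phi -> u @ \oo --> l -> (u \o phi) @ \oo --> l.
Proof.
move=> /increasing_seq_ge phi_ge ul A /ul[N _ NA]; exists N => // n /= Nn.
by apply: NA => /=; exact: leq_trans (phi_ge n).
Qed.

(** An ultrafilter on nat finer than eventually has a limit along every bounded
    sequence, so one choice serves a family of any size.  This takes the place
    of diagonal extractions, both for the coefficients of series and for the
    values of functionals at the points of a bounded sequence. *)
Lemma simultaneous_cluster_point (I : choiceType) (g : I -> nat -> R) :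
  (forall i, exists B, forall j, `|g i j| <= B) ->
  exists L : I -> R, forall (s : seq I) e M, 0 < e ->
    exists2 j, (M <= j)%N & forall i, i \in s -> `|L i - g i j| <= e.
Proof.
move=> gB; have [U [UU Uoo]] := ultraFilterLemma eventually_filter.
have /choice[L LP] : forall i, exists l,
    forall e, 0 < e -> U [set j | `|l - g i j| <= e].
  move=> i; have [B gBi] := gB i.
  have [|l [_ cl]] := @segment_compact R (- B) B (g i @ U) _.
    apply: (@filterS _ U _ setT) => [j _ /=|]; last exact: filterT.
    by rewrite in_itv/= -ler_norml.
  exists l => e e0.
  have [//|/= Unear] := in_ultra_setVsetC [set j | `|l - g i j| <= e] UU.
  have [|r [/= nr rl]] :=
      cl [set r | ~ (`|l - r| <= e)] _ _ (nbhsx_ballx l e e0).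
    exact: Unear.
  by move: rl nr; rewrite -ball_normE /= => /ltW.
exists L => s e M e0.
have Us : U [set j | forall i, i \in s -> `|L i - g i j| <= e].
  elim: s => [|i s IHs]; first by apply: filterS filterT.
  have := LP i e e0; apply: filterS2 IHs => j sj Lij k.
  by rewrite inE => /predU1P[->//|]; exact: sj.
have UM : U [set j | (M <= j)%N] by apply: Uoo; exists M.
have [j [/= sj Mj]] := filter_ex (filterI Us UM).
by exists j.
Qed.

End Sequences.

(** * Convex hulls *)

Section Convexity.
Context {R : realType} {V : normedModType R}.
Implicit Types (A C : set V) (x y : V) (t : R).

Lemma convex_hull_convex A x y t : 0 <= t -> t <= 1 ->
  convex_hull A x -> convex_hull A y -> convex_hull A (t *: x + (1 - t) *: y).
Proof.
move=> t0 t1 Ax Ay C [cC AC].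
have := cC x y (Itv01 t0 t1); rewrite !inE; apply.
- by apply: Ax; split.
- by apply: Ay; split.
Qed.

Lemma sub_convex_hull A : A `<=` convex_hull A.
Proof. exact: sub_gen_smallest. Qed.

Lemma convex_hull_sub A C : A `<=` C ->
  (forall x y t, 0 <= t -> t <= 1 -> C x -> C y -> C (t *: x + (1 - t) *: y)) ->
  convex_hull A `<=` C.
Proof.
move=> AC cC; apply: smallest_sub => // x y t; rewrite !inE; apply: cC.
- exact: ge0.
- exact: le1.
Qed.

Lemma closed_convex_hullP A x : closed_convex_hull A x <->
  forall e, 0 < e -> exists2 y, convex_hull A y & `|x - y| <= e.
Proof.
split=> [Ax e e0|Ax B /nbhs_ballP[e /= e0 eB]].
  have [y [Ay]] := Ax _ (nbhsx_ballx x e e0).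
  by rewrite -ball_normE /= => /ltW xy; exists y.
have [|y Ay xy] := Ax (e / 2); first by rewrite divr_gt0.
exists y; split=> //; apply: eB; rewrite -ball_normE /=.
by apply: le_lt_trans xy _; rewrite ltr_pdivrMr// ltr_pMr// ltr1n.
Qed.

End Convexity.

(** * The dual of a normed space *)

Section DualFacts.
Context {R : realType}.

Lemma dual_apply_le (V : normedModType R) (f : dual V) x :
  `|f x| <= `|f| * `|x|.
Proof. exact: le_op_norm. Qed.

Lemma dual_applyD (V : normedModType R) (f g : dual V) x :
  (f + g) x = f x + g x.
Proof. by []. Qed.

Lemma dual_applyB (V : normedModType R) (f g : dual V) x :
  (f - g) x = f x - g x.
Proof. by []. Qed.

Lemma linear_bounded_dual (V : normedModType R) (f : V -> R^o) M : 0 <= M ->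
  linear f -> (forall x, `|f x| <= M * `|x|) ->
  exists2 y : dual V, (forall x, y x = f x) & `|y| <= M.
Proof.
move=> M0 lf fM.
pose F : {linear V -> R^o} := HB.pack f (GRing.isLinear.Build _ _ _ _ _ lf).
have fd : f \in dual_pred.
  apply/asboolP; split=> //.
  apply: (@bounded_linear_continuous _ _ _ F); apply/linear_boundedP.
  exists M; split; first exact: num_real.
  move=> r /ltW Mr x; apply: (le_trans (fM x)).
  by rewrite ler_wpM2r.
exists (Dual fd) => //; rewrite dual_normE; apply: op_norm_le => x x1 /=.
by apply: (le_trans (fM x)); rewrite -[leRHS]mulr1 ler_wpM2l.
Qed.

Lemma pointwise_limit_dual (V : normedModType R) (u : nat -> dual V)
    (f : V -> R) M :
  (forall n, `|u n| <= M) ->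
  (forall x, (u n x : R^o) @[n --> \oo] --> (f x : R^o)) ->
  exists2 y : dual V, (forall x, y x = f x) & `|y| <= M.
Proof.
move=> uM uf; apply: linear_bounded_dual.
- exact: le_trans (uM 0%N).
- move=> a x y; apply: (@norm_cvg_unique _ R^o (u n (a *: x + y) @[n --> \oo])).
  + exact: uf.
  + rewrite (_ : (fun n => _) = fun n => (a *: (u n x : R^o) + u n y : R^o)).
      by apply: cvgD; [apply: cvgZl_tmp|]; exact: uf.
    by apply/funext => n; exact: dual_linear.
move=> x; apply/ler_addgt0Pl => e e0.
have /cvg_seqP /(_ e e0)[N /(_ N (leqnn N)) fu] := uf x.
rewrite -[f x](subrK (u N x)); apply: (le_trans (ler_normD _ _)).
apply: lerD; first exact: fu.
apply: (le_trans (dual_apply_le (u N) x)).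
by rewrite ler_wpM2r.
Qed.

Lemma weak_star_null_bounded (V : completeNormedModType R) (u : nat -> dual V) :
  (forall x, (u n x : R^o) @[n --> \oo] --> (0 : R^o)) ->
  exists2 M, 0 <= M & forall n, `|u n| <= M.
Proof.
move=> u0.
have [f [n _ <-]||M uM] :=
    @Banach_Steinhauss R V R^o [set (u n : V -> R^o) | n in setT] _ _ 1.
- split; last exact: dual_linear.
  move=> r; exists (`|u n| * r) => x xr.
  by apply: (le_trans (dual_apply_le _ _)); rewrite ler_wpM2l.
- move=> x; have /cvgP/cvg_seq_bounded := u0 x.
  move=> [B [_ /(_ (B + 1))]]; rewrite ltrDl ltr01 => /(_ isT) uB.
  by exists (B + 1) => _ [n _ <-]; exact: uB.
have Mu n : `|u n| <= M.
  rewrite dual_normE; apply: op_norm_le => x x1.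
  by apply: (uM (u n)) => //; exists n.
by exists M => //; exact: le_trans (Mu 0%N).
Qed.

End DualFacts.

(** * The modulus on the dual of a Banach lattice *)

Section DualLatticeFacts.
Context {R : realType} {E : banachLatticeType R}.
Implicit Types (f g : dual E) (x y z : E).

Lemma dual_ge0 f x : 0 ⊑ f -> 0 ⊑ x -> 0 <= f x.
Proof. by move=> /(_ x). Qed.

Lemma leN_modulus (F : rieszSpaceType R) (x : F) : - modulus x ⊑ x.
Proof. by rewrite -[X in _ ⊑ X]opprK; apply: rleN2; exact: rle_supr. Qed.

(** By the Riesz-Kantorovich formula, the value at x of the modulus of f is the
    supremum of 2 f(y) - f(x) = f(2y - x) over y between 0 and x, and then
    2y - x runs through the order interval from -x to x. *)
Lemma dual_modulus_lub f x c : 0 ⊑ x ->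
  (forall z, - x ⊑ z -> z ⊑ x -> f z <= c) -> modulus f x <= c.
Proof.
move=> x0 fc.
have -> : modulus f = - f + dual_pos (f + f).
  by rewrite /modulus /rsup /= /dual_sup -lock opprK.
rewrite dual_applyD /= pos_fun_id// -lerBrDl.
apply: pos_cone_lub => // y y0 yx.
rewrite lerBrDr (_ : _ + _ = f (y - x + y)); last first.
  by rewrite -[LHS]/(f y + f y - f x) !linearD linearN/=; ring.
apply: fc.
  rewrite -[X in X ⊑ _]addr0 -[X in X + _]add0r.
  by apply: rleD => //; apply: rleD2r.
rewrite -[X in _ ⊑ X]add0r; apply: rleD => //.
by rewrite -(subrr x); exact: rleD2r.
Qed.

(** With |.| for the modulus, expand the nonnegative numbers
    (|f| - f)(|x| + x) and (|f| + f)(|x| - x) and add them up. *)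
Lemma le_dual_modulus f x : `|f x| <= modulus f (modulus x).
Proof.
have le g z : g z <= modulus g (modulus z).
  have z1 : 0 ⊑ modulus z - z by apply: rsub_ge0; exact: rle_supl.
  have z2 : 0 ⊑ modulus z + z.
    by rewrite addrC -[X in _ + X]opprK; apply: rsub_ge0; exact: leN_modulus.
  have g1 : 0 ⊑ modulus g - g by apply: rsub_ge0; exact: rle_supl.
  have g2 : 0 ⊑ modulus g + g.
    by rewrite addrC -[X in _ + X]opprK; apply: rsub_ge0; exact: leN_modulus.
  have h1 := dual_ge0 g1 z2; have h2 := dual_ge0 g2 z1.
  by move: h1 h2; rewrite dual_applyB dual_applyD !linearD !linearN/=; lra.
rewrite ler_norml le andbT lerNl.
by have := le f (- x); rewrite linearN/= /modulus opprK [- x ⊔ x]rsupC.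
Qed.

Lemma norm_dual_modulus f : `|f| <= `|modulus f|.
Proof.
rewrite dual_normE; apply: op_norm_le => x x1.
apply: (le_trans (le_dual_modulus f x)).
apply: (le_trans (ler_norm _)); apply: (le_trans (dual_apply_le _ _)).
by rewrite norm_modulus -[leRHS]mulr1 ler_wpM2l.
Qed.

End DualLatticeFacts.

(** * Grothendieck's compactness principle *)

Section GrothendieckCompactness.
Context {R : realType} {V : normedModType R}.
Implicit Types (K : set V).

Lemma half_pow_small (e : R) : 0 < e ->
  exists N, forall n, (N <= n)%N -> 2^-1 ^+ n <= e.
Proof.
move=> e0; have h : `|2^-1 : R| < 1 by rewrite ger0_norm ?invf_lt1 ?ltr1n.
have /cvg_seq0P /(_ e e0)[N NP] := cvg_expr h.
by exists N => n /NP; rewrite ger0_norm ?exprn_ge0.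
Qed.

(** Without a finite e-net, adding one point at a time at distance more than e
    from all the previous ones gives a sequence of K without any Cauchy
    subsequence. *)
Lemma seq_compact_net K :
  (forall u : nat -> V, (forall n, K (u n)) ->
    exists phi f, increasing_seq phi /\ (u \o phi) @ \oo --> (f : V)) ->
  forall e, 0 < e ->
    exists s : seq V, forall x, K x -> exists2 y, y \in s & `|x - y| <= e.
Proof.
move=> cK e e0; apply: contrapT => noNet.
have /choice[g gP] : forall s : seq V, exists x,
    K x /\ forall y, y \in s -> ~ `|x - y| <= e.
  move=> s; apply: contrapT => nx; apply: noNet; exists s => x Kx.
  apply: contrapT => ny; apply: nx; exists x; split=> // y ys xy.
  by apply: ny; exists y.
pose S n := iter n (fun s => g s :: s) [::].
have SP i n : (i < n)%N -> g (S i) \in S n.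
  elim: n => // n IH; rewrite ltnS leq_eqVlt => /predU1P[->|/IH].
    by rewrite inE eqxx.
  by rewrite [S n.+1]/= inE orbC => ->.
have [phi [f [phi_inc uf]]] := cK (fun n => g (S n)) (fun n => (gP (S n)).1).
have e2 : 0 < e / 2 by rewrite divr_gt0.
have /cvg_seqP/(_ _ e2)[N fN] := uf.
have lt : (phi N < phi N.+1)%N by have /increasing_seqP := phi_inc; exact.
have [_ /(_ _ (SP _ _ lt))] := gP (S (phi N.+1)); apply.
rewrite -(subrKA f) (splitr e) (le_trans (ler_normD _ _))// lerD//.
  by rewrite distrC; exact: fN.
exact: fN.
Qed.

(** The weights add up to 1 - 2^-N: the missing 2^-N is carried by 0. *)
Lemma convex_dyadic_sum (C : set V) (s : nat -> V) N :
  (forall x y t, 0 <= t -> t <= 1 -> C x -> C y -> C (t *: x + (1 - t) *: y)) ->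
  C 0 -> (forall k, C (s k)) -> C (\sum_(k < N) 2^-1 ^+ k.+1 *: s k).
Proof.
move=> cC C0; elim: N s => [|N IH] s Cs; first by rewrite big_ord0.
rewrite big_ord_recl expr1.
rewrite (_ : \sum_(i < N) _ =
    (1 - 2^-1) *: \sum_(k < N) 2^-1 ^+ k.+1 *: s k.+1).
  apply: cC => //; first by rewrite invf_le1 ?ler1n.
  exact: (IH (fun k => s k.+1)).
rewrite scaler_sumr; apply: eq_bigr => k _; rewrite scalerA exprS.
by congr (_ * _ *: _); lra.
Qed.

(** The finite sets S n are listed through the bijection of nat * nat with a
    subset of nat; the indices that encode no element of any S n are sent to
    0, so that 0 is a value of u. *)
Lemma enumerate_null (S : nat -> seq V) (c : R) : 0 < c ->
  (forall n z, z \in S n.+1 -> `|z| <= c * 2^-1 ^+ n) ->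
  exists u : nat -> V, [/\ u @ \oo --> (0 : V), range u 0 &
    forall n z, z \in S n -> range u z].
Proof.
move=> c0 Sc.
pose u m := if @pickle_inv (nat * nat)%type m is Some (n, i)
            then nth 0 (S n) i else 0.
have uE n i : u (pickle (n, i)) = nth 0 (S n) i by rewrite /u pickleK_inv.
exists u; split; last 2 first.
- by exists (pickle (0, size (S 0))%N) => //; rewrite uE nth_default.
- move=> n z zS; exists (pickle (n, index z (S n))) => //.
  by rewrite uE nth_index.
apply/cvg_seq0P => e e0.
have [N NP] := half_pow_small (divr_gt0 e0 c0).
exists (\max_(n < N.+1) \max_(i < size (S n))
  (pickle (nat_of_ord n, nat_of_ord i)).+1)%N.
move=> m Mm; rewrite /u; case um : pickle_inv => [[n i]|]; last first.
  by rewrite normr0 ltW.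
have mE : pickle (n, i) = m.
  by have := @pickle_invK (nat * nat)%type m; rewrite um.
have [iS|iS] := ltnP i (size (S n)); last by rewrite nth_default// normr0 ltW.
have [nN|] := ltnP n N.+1; last first.
  case: n {um mE} iS => // n iS Nn.
  apply: (le_trans (Sc n _ (mem_nth _ iS))).
  by rewrite mulrC -ler_pdivlMr//; exact: NP.
exfalso; move: Mm; apply/negP; rewrite -ltnNge -mE.
apply: leq_trans (leq_bigmax (Ordinal nN)).
exact: (leq_bigmax (Ordinal iS)).
Qed.

(** Let F n be a finite 4^-n-net of K and approximate x in K by y n in F n.
    Then y N = 2 (y 0) / 2 + \sum_(n < N) 2^(n+2) (y (n+1) - y n) / 2^(n+2) is
    a dyadic sum of multiples of differences of net points.  These multiples
    have norm at most 8 / 2^n, and there are finitely many of them for each n,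
    so that together they form a null sequence which does not depend on x. *)
Lemma totally_bounded_sub_null_hull K :
  (forall e, 0 < e ->
    exists s : seq V, forall x, K x -> exists2 y, y \in s & `|x - y| <= e) ->
  exists u : nat -> V,
    u @ \oo --> (0 : V) /\ K `<=` closed_convex_hull (range u).
Proof.
move=> tbK.
have p4 n : 0 < (2^-1 ^+ n * 2^-1 ^+ n : R).
  by rewrite mulr_gt0 ?exprn_gt0 ?invr_gt0.
have /choice[F FP] n := tbK _ (p4 n).
pose S n := if n is n'.+1 then
    [seq z <- [seq 2 ^+ n'.+2 *: (a - b) | a <- F n'.+1, b <- F n']
      | `|z| <= 8 * 2^-1 ^+ n']
  else [seq 2 *: a | a <- F 0%N].
have [|n z|u [u0 uz uS]] := @enumerate_null S 8; first by [].
  by rewrite /S mem_filter => /andP[].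
exists u; split=> // x Kx; apply/closed_convex_hullP => e e0.
have /choice[y yP] : forall n, exists y, y \in F n /\
    `|x - y| <= 2^-1 ^+ n * 2^-1 ^+ n.
  by move=> n; have [y yF xy] := FP n x Kx; exists y.
pose s n := if n is n'.+1 then 2 ^+ n'.+2 *: (y n'.+1 - y n') else 2 *: y 0%N.
have sS n : s n \in S n.
  case: n => [|n] /=; first by apply: map_f; have [] := yP 0%N.
  have [yn xyn] := yP n; have [ym xym] := yP n.+1.
  rewrite mem_filter; apply/andP; split; last exact: allpairs_f.
  rewrite normrZ ger0_norm ?exprn_ge0//.
  apply: (@le_trans _ _ (2 ^+ n.+2 * (2 * (2^-1 ^+ n * 2^-1 ^+ n)))).
    rewrite ler_pM2l ?exprn_gt0// -(subrKA x) mulrC mulr_natr mulr2n.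
    apply: (le_trans (ler_normD _ _)); apply: lerD => //.
    rewrite distrC; apply: (le_trans xym); apply: ler_pM; rewrite ?exprn_ge0//.
      by rewrite exprS ler_piMl ?exprn_ge0// invf_le1 ?ler1n.
    by rewrite exprS ler_piMl ?exprn_ge0// invf_le1 ?ler1n.
  rewrite !exprS exprVn; set t := 2 ^+ n.
  have t0 : t != 0 by rewrite expf_neq0.
  by rewrite le_eqVlt; apply/orP; left; apply/eqP; field.
have yE N : \sum_(k < N.+1) 2^-1 ^+ k.+1 *: s k = y N.
  elim: N => [|N IH].
    by rewrite big_ord1 expr1 /s scalerA mulVf// scale1r.
  rewrite big_ord_recr IH /= scalerA -exprMn mulVf// expr1n scale1r.
  by rewrite addrC subrK.
have [N NP] := half_pow_small e0.
exists (y N).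
  rewrite -yE; apply: convex_dyadic_sum.
  - by move=> *; exact: convex_hull_convex.
  - exact: sub_convex_hull.
  - by move=> k; apply: sub_convex_hull; exact: uS (sS k).
have [_ xyN] := yP N; apply: (le_trans xyN).
apply: le_trans (NP N (leqnn N)); rewrite ler_piMl ?exprn_ge0//.
by rewrite exprn_ile1// invf_le1 ?ler1n.
Qed.

End GrothendieckCompactness.

(** * Sublinear functionals and the Hahn-Banach theorem *)

Section HahnBanach.
Context {R : realType} {V : lmodType R}.
Implicit Types (p q : V -> R) (x y z : V).

Definition sublinear q : Prop :=
  (forall x y, q (x + y) <= q x + q y) /\
  (forall t x, 0 <= t -> q (t *: x) <= t * q x).

Lemma sublinear0 q : sublinear q -> q 0 = 0.
Proof.
move=> [qD qZ]; have := qD 0 0; have := qZ 0 0 (lexx 0).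
by rewrite scale0r mul0r addr0; lra.
Qed.

Lemma sublinear_ge q x : sublinear q -> - q (- x) <= q x.
Proof.
move=> sq; have := sq.1 x (- x).
by rewrite subrr (sublinear0 sq); lra.
Qed.

(** Subadditivity of the infimum asks for one member of the family below the
    sum of any two, at the sum of two points.  Chains of sublinear functionals
    and the perturbations of a single one along a convex set both qualify. *)
Lemma sublinear_inf (I : Type) (D : set I) (h : I -> V -> R) (p : V -> R) :
  D !=set0 ->
  (forall i x, D i -> - p x <= h i x) ->
  (forall i j x y, D i -> D j ->
    exists2 k, D k & h k (x + y) <= h i x + h j y) ->
  (forall t i x, D i -> 0 <= t -> exists2 k, D k & h k (t *: x) <= t * h i x) ->
  exists q, [/\ sublinear q, (forall i x, D i -> q x <= h i x) &
    (forall x c, (forall i, D i -> c <= h i x) -> c <= q x)].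
Proof.
move=> D0 hlb hD hZ.
pose q x := inf [set h i x | i in D].
have hinf x : has_inf [set h i x | i in D].
  split; first by have [i Di] := D0; exists (h i x), i.
  by exists (- p x) => _ [i Di <-]; exact: hlb.
have qle i x : D i -> q x <= h i x.
  by move=> Di; apply: ge_inf; [case: (hinf x)|exists i].
have qge x c : (forall i, D i -> c <= h i x) -> c <= q x.
  move=> ch; apply: lb_le_inf; first by case: (hinf x).
  by move=> _ [i Di <-]; exact: ch.
exists q; split; [split=> [x y|t x t0]|exact: qle|exact: qge].
  rewrite -lerBlDr; apply: (qge) => i Di; rewrite lerBlDr [leRHS]addrC -lerBlDr.
  apply: (qge) => j Dj; rewrite lerBlDr [leRHS]addrC.
  by have [k Dk] := hD i j x y Di Dj; apply: le_trans; exact: qle.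
have [->|tn0] := eqVneq t 0.
  have [i Di] := D0; have [k Dk hk] := hZ 0 i x Di (lexx 0).
  by rewrite mul0r; apply: (le_trans (qle k _ Dk)); rewrite mul0r in hk.
have tp : 0 < t by rewrite lt_def tn0.
rewrite -ler_pdivrMl//; apply: (qge) => i Di; rewrite ler_pdivrMl//.
by have [k Dk] := hZ t i x Di t0; apply: le_trans; exact: qle.
Qed.

(** Take for p x the infimum of q (x + t w) - t c over t >= 0 and w in C; the
    bound c <= q on C keeps it above - q (- x). *)
Lemma sublinear_lower q (C : set V) (c : R) : sublinear q -> C !=set0 ->
  (forall x y t, 0 <= t -> t <= 1 -> C x -> C y -> C (t *: x + (1 - t) *: y)) ->
  (forall w, C w -> c <= q w) ->
  exists p, [/\ sublinear p, (forall x, p x <= q x) &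
    (forall x w, C w -> p x <= q (x + w) - c)].
Proof.
move=> sq [w0 Cw0] cC cq; have [qD qZ] := sq.
pose D := [set i : R * V | 0 <= i.1 /\ C i.2].
pose h (i : R * V) x := q (x + i.1 *: i.2) - i.1 * c.
have qZge t x : 0 <= t -> t * q x <= q (t *: x).
  move=> t0; have [->|tn0] := eqVneq t 0.
    by rewrite scale0r mul0r (sublinear0 sq).
  have tp : 0 < t by rewrite lt_def tn0.
  rewrite -ler_pdivlMl//; have := qZ t^-1 (t *: x).
  by rewrite scalerA mulVf// scale1r; apply; rewrite invr_ge0.
have [||||p [sp pq pge]] := @sublinear_inf _ D h (fun x => q (- x)).
- by exists (0, w0); split.
- move=> [t w] x [/= t0 Cw]; rewrite /h /=.
  have h1 := qD (x + t *: w) (- x); have h2 := qZge t w t0.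
  have h3 := ler_wpM2l t0 (cq w Cw).
  by move: h1; rewrite addrAC subrr add0r; lra.
- move=> [t w] [s v] x y [/= t0 Cw] [/= s0 Cv].
  have [ts|ts] := eqVneq (t + s) 0.
    exists (0, w); first by split.
    have [-> ->] : t = 0 /\ s = 0 by split; lra.
    by rewrite /h /= !mul0r !scale0r !addr0 !subr0; exact: qD.
  have tsp : 0 < t + s by rewrite lt_def ts addr_ge0.
  (* t w + s v is t + s times a point of C *)
  exists (t + s, (t / (t + s)) *: w + (1 - t / (t + s)) *: v).
    split; rewrite /= ?addr_ge0//; apply: cC => //.
    + by rewrite divr_ge0 ?addr_ge0.
    + by rewrite ler_pdivrMr// mul1r lerDl.
  rewrite /h /= scalerDr !scalerA.
  have -> : (t + s) * (t / (t + s)) = t by field.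
  have -> : (t + s) * (1 - t / (t + s)) = s by field.
  by have := qD (x + t *: w) (y + s *: v); rewrite addrACA mulrDl; lra.
- move=> r [t w] x [/= t0 Cw] r0; exists (r * t, w).
    by split; rewrite //= mulr_ge0.
  by rewrite /h /= -scalerA -scalerDr; have := qZ r (x + t *: w) r0; lra.
exists p; split=> // [x|x w Cw].
  have := @pq (0, w0) x; rewrite /h /= scale0r addr0 mul0r subr0; apply.
  by split.
by have := @pq (1, w) x; rewrite /h /= scale1r mul1r; apply; split.
Qed.

Lemma exists_minimal_sublinear p : sublinear p ->
  exists q, [/\ sublinear q, (forall x, q x <= p x) &
    forall q', sublinear q' -> (forall x, q' x <= q x) ->
      forall x, q x <= q' x].
Proof.
move=> sp.
pose T := {q : V -> R | sublinear q /\ forall x, q x <= p x}.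
pose le (q1 q2 : T) := `[< forall x, proj1_sig q2 x <= proj1_sig q1 x >].
pose t0 : T := exist _ p (conj sp (fun x => lexx _)).
have [t|r s t /asboolP rs /asboolP st|A Atot|] := @ZL_preorder T t0 le.
- exact/asboolP.
- by apply/asboolP => x; apply: le_trans (st x) (rs x).
- have [[q0 Aq0]|A0] := pselect (A !=set0); last first.
    by exists t0 => s As; exfalso; apply: A0; exists s.
  have [|||| q [sq qA _]] :=
      @sublinear_inf T A (fun q : T => proj1_sig q) (fun x => p (- x)).
  + by exists q0.
  + move=> [q [sq qp]] x _ /=; apply: le_trans (sublinear_ge _ sq).
    by rewrite lerN2.
  + move=> q1 q2 x y A1 A2.
    have [/asboolP l|/asboolP l] := Atot _ _ A1 A2.
      exists q2 => //; have [[qD _] _] := proj2_sig q2.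
      by apply: (le_trans (qD x y)); rewrite lerD2r.
    exists q1 => //; have [[qD _] _] := proj2_sig q1.
    by apply: (le_trans (qD x y)); rewrite lerD2l.
  + move=> t q x Aq t0'; exists q => //.
    by have [[_ qZ] _] := proj2_sig q; exact: qZ.
  have qp x : q x <= p x.
    by apply: (le_trans (qA q0 x Aq0)); have [_] := proj2_sig q0; exact.
  exists (exist _ q (conj sq qp)) => s As; apply/asboolP => x /=.
  exact: qA.
move=> [q [sq qp]] qmax; exists q; split=> // q' sq' q'q x.
have q'p y : q' y <= p y by exact: le_trans (qp y).
have qq' : le (exist _ q (conj sq qp)) (exist _ q' (conj sq' q'p)).
  exact/asboolP.
by have /asboolP := qmax _ qq'; exact.
Qed.

(** A minimal sublinear q below p is linear: lowering it along the singleton of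
    y with c = q y cannot change it, whence q x <= q (x + y) - q y. *)
Lemma Hahn_Banach p : sublinear p ->
  exists2 f : V -> R^o, linear f & forall x, f x <= p x.
Proof.
move=> sp; have [q [sq qp qmin]] := exists_minimal_sublinear sp.
exists q => //; have [qsub qZle] := sq; have q0 := sublinear0 sq.
have qD x y : q (x + y) = q x + q y.
  apply/eqP; rewrite eq_le qsub/=.
  have [||||q' [sq' q'q q'y]] := @sublinear_lower q [set y] (q y).
  - by [].
  - by exists y.
  - by move=> _ _ t _ _ -> ->; rewrite -scalerDl addrC subrK scale1r.
  - by move=> _ ->.
  by have := qmin q' sq' q'q x; have := q'y x y erefl; lra.
have qN x : q (- x) = - q x.
  by have := qD x (- x); rewrite subrr q0; lra.
have qZ t x : 0 <= t -> q (t *: x) = t * q x.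
  move=> t0; apply/eqP; rewrite eq_le qZle//=.
  by have := qZle t (- x) t0; rewrite scalerN !qN; lra.
move=> t x y; rewrite qD; congr (_ + _).
have [t0|t0] := leP 0 t; first exact: qZ.
have := qZ (- t) x; rewrite scaleNr qN => /(_ _)/eqP.
by rewrite oppr_ge0 ltW// => /(_ isT); rewrite mulNr eqr_opp => /eqP.
Qed.

End HahnBanach.

(** * Mazur's lemma *)

Section Mazur.
Context {R : realType} {V : normedModType R}.

Lemma sublinear_norm : sublinear (fun x : V => `|x|).
Proof.
split=> [x y|t x t0]; first exact: ler_normD.
by rewrite normrZ ger0_norm.
Qed.

(** If the convex hull misses the ball of radius e, lowering the norm along the
    hull with c = e gives a sublinear functional which is at most - e at each
    - u n; a linear functional below it is bounded and at least e at each
    u n. *)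
Lemma Mazur (u : nat -> V) :
  (forall f : dual V, (f (u n) : R^o) @[n --> \oo] --> (0 : R^o)) ->
  forall e, 0 < e -> exists2 w, convex_hull (range u) w & `|w| <= e.
Proof.
move=> u0 e e0; apply: contrapT => nw.
have [|x y t|w hw|p [sp pn pw]] :=
    @sublinear_lower R V _ (convex_hull (range u)) e sublinear_norm.
- by exists (u 0%N); apply: sub_convex_hull; exists 0%N.
- exact: convex_hull_convex.
- by rewrite leNgt; apply/negP => /ltW we; apply: nw; exists w.
have [f lf fp] := Hahn_Banach sp.
have fN x : f (- x) = - f x.
  pose F : {linear V -> R^o} := HB.pack f (GRing.isLinear.Build _ _ _ _ _ lf).
  exact: (linearN F).
have f1 x : `|f x| <= 1 * `|x|.
  rewrite mul1r ler_norml lerNl -fN; apply/andP; split.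
    by rewrite -[leRHS]normrN (le_trans (fp _)).
  exact: le_trans (fp _) _.
have [g gf _] := linear_bounded_dual ler01 lf f1.
have e2 : 0 < e / 2 by rewrite divr_gt0.
have /cvg_seq0P/(_ _ e2)[N /(_ N (leqnn N))] := u0 g.
rewrite gf; have := pw (- u N) (u N); rewrite addNr normr0.
have := fp (- u N); rewrite fN => h1 h2.
have {}h2 := h2 (sub_convex_hull (ex_intro2 _ _ N I erefl)).
by move=> /(le_trans (ler_norm _)); lra.
Qed.

End Mazur.

(** * The absolute weak* topology *)

Section AbsWeakStar.
Context {R : realType} {E : banachLatticeType R}.
Implicit Types (u : nat -> dual E) (f g : dual E) (x z : E).

Lemma weak_star_nullP u : u @ \oo --> ((0 : dual E) : weak_star E) <->
  forall x, (u n x : R^o) @[n --> \oo] --> (0 : R^o).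
Proof. exact: cvg_weak_starP. Qed.

Lemma cvg_abs_weak_star_seqP u f : u @ \oo --> (f : abs_weak_star E) <->
  forall x, 0 ⊑ x -> (modulus (u n - f) x : R^o) @[n --> \oo] --> (0 : R^o).
Proof.
split=> [/cvg_abs_weak_starP uf x x0|uf].
  by have := uf x; rewrite (modulus_id x0).
by apply/cvg_abs_weak_starP => x; exact: uf (modulus_ge0 x).
Qed.

Lemma abs_weak_star_nullP u : abs_weak_star_null u <->
  forall x, 0 ⊑ x -> (modulus (u n) x : R^o) @[n --> \oo] --> (0 : R^o).
Proof.
apply: (iff_trans (cvg_abs_weak_star_seqP _ _)).
by under eq_forall do under eq_fun do rewrite subr0.
Qed.

Lemma dual_modulus_le_norm f x : 0 ⊑ x -> modulus f x <= `|f| * `|x|.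
Proof.
move=> x0; apply: dual_modulus_lub => // z xz zx.
apply: (le_trans (ler_norm _)); apply: (le_trans (dual_apply_le _ _)).
rewrite ler_wpM2l//; apply: lattice_norm; rewrite (modulus_id x0).
by apply/rsup_le; split=> //; rewrite -[X in _ ⊑ X]opprK; exact: rleN2.
Qed.

Lemma norm_null_abs_weak_star_null u :
  u @ \oo --> (0 : dual E) -> abs_weak_star_null u.
Proof.
move=> /cvg_seq0P u0; apply/abs_weak_star_nullP => x x0.
apply/cvg_seq0P => e e0.
have d0 : 0 < e / (`|x| + 1) by rewrite divr_gt0// ltr_wpDl.
have [N NP] := u0 _ d0; exists N => n /NP un.
rewrite ger0_norm; last exact: dual_ge0 (modulus_ge0 _) x0.
apply: (le_trans (dual_modulus_le_norm _ x0)).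
apply: (@le_trans _ _ (e / (`|x| + 1) * (`|x| + 1))).
  by apply: ler_pM => //; rewrite lerDl.
by rewrite divfK// gt_eqF// ltr_wpDl.
Qed.

Lemma abs_weak_star_null_modulus u : abs_weak_star_null u ->
  (fun n => modulus (u n)) @ \oo --> ((0 : dual E) : weak_star E).
Proof.
move=> /abs_weak_star_nullP u0; apply/weak_star_nullP => x.
rewrite -(rposB x) -[0]subr0.
rewrite (_ : (fun n => _) = fun n => (modulus (u n) (rpos x) : R^o)
    - modulus (u n) (rpos (- x))); last first.
  by apply/funext => n; rewrite linearB.
by apply: cvgB; apply: u0; exact: rpos_ge0.
Qed.

Lemma cvg_abs_weak_star_pointwise u f : u @ \oo --> (f : abs_weak_star E) ->
  forall x, (u n x : R^o) @[n --> \oo] --> (f x : R^o).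
Proof.
move=> /cvg_abs_weak_star_seqP uf x; apply/cvg_seqP => e e0.
have /cvg_seq0P/(_ _ e0)[N NP] := uf _ (modulus_ge0 x).
exists N => n /NP; rewrite ger0_norm; last first.
  by apply: dual_ge0; exact: modulus_ge0.
by apply: le_trans; rewrite distrC; exact: (le_dual_modulus (u n - f)).
Qed.

Lemma abs_weak_star_null_pos u : (forall n, 0 ⊑ u n) ->
  u @ \oo --> ((0 : dual E) : weak_star E) -> abs_weak_star_null u.
Proof.
move=> upos /weak_star_nullP u0; apply/abs_weak_star_nullP => x _.
by under eq_fun do rewrite (modulus_id (upos _)); exact: u0.
Qed.

End AbsWeakStar.

(** * An absolutely weak* compact set built on a weak* null sequence *)

Section SeriesHull.
Context {R : realType} {E : banachLatticeType R}.
Implicit Types (u : nat -> dual E) (f y : dual E) (x z : E) (s : R).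

(** Recording the coefficients, instead of closing up the convex hull of u,
    lets compactness be read off from their coordinatewise convergence. *)
Definition series_hull u s : set (dual E) :=
  [set y | exists a : nat -> R, [/\ forall n, 0 <= a n,
    forall N, \sum_(0 <= n < N) a n <= s &
    forall x, (\sum_(0 <= n < N) a n * u n x : R^o) @[N --> \oo]
      --> (y x : R^o)]].

Lemma series_hull_convex u s y1 y2 (t : R) : 0 <= t -> t <= 1 ->
  series_hull u s y1 -> series_hull u s y2 ->
  series_hull u s (t *: y1 + (1 - t) *: y2).
Proof.
move=> t0 t1 [a [a0 aS ay]] [b [b0 bS by2]].
have t1' : 0 <= 1 - t by rewrite subr_ge0.
exists (fun n => t * a n + (1 - t) * b n); split=> [n|N|z].
- by rewrite addr_ge0 ?mulr_ge0.
- rewrite big_split/= -!mulr_sumr.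
  have := ler_wpM2l t0 (aS N); have := ler_wpM2l t1' (bS N); lra.
- rewrite (_ : (fun N => _) = fun N =>
      t *: (\sum_(0 <= n < N) a n * u n z : R^o)
      + (1 - t) *: (\sum_(0 <= n < N) b n * u n z : R^o)).
    by apply: cvgD; apply: cvgZl_tmp; [exact: ay|exact: by2].
  apply/funext => N; rewrite /GRing.scale /= !mulr_sumr -big_split/=.
  by apply: eq_bigr => n _; rewrite mulrDl !mulrA.
Qed.

Lemma sum_indicator (c : nat -> R) n N :
  \sum_(0 <= k < N) (k == n)%:R * c k = if (n < N)%N then c n else 0.
Proof.
rewrite big_mkord; case: ltnP => nN.
  rewrite (bigD1 (Ordinal nN))//= eqxx mul1r big1 ?addr0// => i.
  by rewrite -val_eqE/= => /negbTE ->; rewrite mul0r.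
rewrite big1// => i _; rewrite ltn_eqF ?mul0r//.
exact: leq_trans nN.
Qed.

Lemma mem_series_hull u n : series_hull u 1 (u n).
Proof.
exists (fun k => (k == n)%:R); split=> [k|N|x].
- exact: ler0n.
- under eq_bigr do rewrite -[_%:R]mulr1.
  by rewrite (sum_indicator (fun=> 1)); case: ifP.
- apply/cvg_seqP => e e0; exists n.+1 => N nN.
  by rewrite (sum_indicator (fun k => u k x)) nN subrr normr0 ltW.
Qed.

Lemma series_hull_scale u s (t : R) y : 0 <= t ->
  series_hull u s y -> series_hull u (t * s) (t *: y).
Proof.
move=> t0 [a [a0 aS ay]]; exists (fun n => t * a n); split=> [n|N|x].
- exact: mulr_ge0.
- by rewrite -mulr_sumr ler_wpM2l.
- rewrite (_ : (fun N => _) = fun N =>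
      t *: (\sum_(0 <= n < N) a n * u n x : R^o)).
    by apply: cvgZl_tmp; exact: ay.
  apply/funext => N; rewrite /GRing.scale /= mulr_sumr.
  by apply: eq_bigr => n _; rewrite mulrA.
Qed.

Lemma pos_dual_bound f x z : 0 ⊑ f -> - x ⊑ z -> z ⊑ x -> `|f z| <= f x.
Proof.
move=> f0 xz zx; have := dual_ge0 f0 (rsub_ge0 xz).
have := dual_ge0 f0 (rsub_ge0 zx).
rewrite opprK !linearD !linearN/= ler_norml => h1 h2.
by apply/andP; split; lra.
Qed.

Lemma series_hull_limit u M s (a : nat -> R) :
  0 <= M -> (forall n, `|u n| <= M) ->
  (forall n, 0 <= a n) -> (forall N, \sum_(0 <= n < N) a n <= s) ->
  exists y : dual E, forall x,
    (\sum_(0 <= n < N) a n * u n x : R^o) @[N --> \oo] --> (y x : R^o).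
Proof.
move=> M0 uM a0 aS; pose S N := \sum_(0 <= n < N) a n *: u n.
have SE N x : S N x = \sum_(0 <= n < N) a n * u n x.
  rewrite /S; elim: N => [|N IH]; first by rewrite !big_geq.
  rewrite [in RHS]big_nat_recr//= -IH -[a N * u N x]/((a N *: u N) x).
  rewrite -dual_applyD.
  by rewrite big_nat_recr.
have SM N : `|S N| <= s * M.
  apply: (le_trans (ler_norm_sum _ _ _)).
  apply: (@le_trans _ _ (\sum_(0 <= n < N) a n * M)).
    by apply: ler_sum => n _; rewrite normrZ ger0_norm// ler_wpM2l.
  by rewrite -mulr_suml ler_wpM2r.
have Scvg x : cvgn (series (fun n => a n * u n x : R^o)).
  apply: normed_cvg.
  apply: (@series_le_cvg _ _ (fun n => a n * (M * `|x|))) => [n|n|n|].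
  - exact: normr_ge0.
  - by rewrite !mulr_ge0.
  - rewrite /= -[X in `|X|]/(a n *: (u n x : R^o)) normrZ ger0_norm//.
    rewrite ler_wpM2l//; apply: (le_trans (dual_apply_le _ _)).
    by rewrite ler_wpM2r.
  - apply: nondecreasing_is_cvgn.
      by apply: nondecreasing_series => n _ _; rewrite !mulr_ge0.
    exists (s * (M * `|x|)) => _ [N _ <-].
    by rewrite /series/= -mulr_suml ler_wpM2r// mulr_ge0.
have [|y yx _] := @pointwise_limit_dual _ _ S
    (fun x => limn (series (fun n => a n * u n x : R^o))) (s * M) SM.
  by move=> x; under eq_fun do rewrite SE; exact: Scvg.
by exists y => x; rewrite yx; exact: Scvg.
Qed.

Lemma cvg_finite_sum (f : nat -> nat -> R) (l : nat -> R) N :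
  (forall n, (f i n : R^o) @[i --> \oo] --> (l n : R^o)) ->
  (\sum_(0 <= n < N) f i n : R^o) @[i --> \oo]
    --> (\sum_(0 <= n < N) l n : R^o).
Proof.
move=> fl; elim: N => [|N IH].
  by under eq_fun do rewrite big_geq//; rewrite big_geq//; exact: cvg_cst.
rewrite big_nat_recr//=; under eq_fun do rewrite big_nat_recr//=.
by apply: cvgD; [exact: IH|exact: fl].
Qed.

(** Extract a subsequence along which the coefficients converge one by one.
    Against x >= 0 the head of the difference of two series tends to 0, being a
    finite sum, and the tail is small because the u n x are, uniformly in the
    coefficients, whose sums are bounded by s.  Positivity of u bounds
    u n on the whole order interval from - x to x by u n x, so that the estimate
    holds for the modulus. *)
Lemma series_hull_compact u s : 0 <= s -> (forall n, 0 ⊑ u n) ->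
  u @ \oo --> ((0 : dual E) : weak_star E) ->
  seq_abs_weak_star_compact (series_hull u s).
Proof.
move=> s0 upos /weak_star_nullP u0 y yC.
have [M M0 uM] := weak_star_null_bounded u0.
have /choice[a aP] := yC.
have a0 k n : 0 <= a k n by have [] := aP k.
have aS k N : \sum_(0 <= n < N) a k n <= s by have [] := aP k.
have ay k x : (\sum_(0 <= n < N) a k n * u n x : R^o) @[N --> \oo]
    --> (y k x : R^o) by have [] := aP k.
have as_ k n : `|a k n| <= s.
  rewrite ger0_norm//; apply: le_trans (aS k n.+1).
  by rewrite big_nat_recr//= lerDr; apply: sumr_ge0.
have [L LP] := @simultaneous_cluster_point R nat (fun n k => a k n)
  (fun n => ex_intro _ s (fun k => as_ k n)).
have h0 : 0 < 2^-1 :> R by rewrite invr_gt0.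
have [phi [phi_inc phiP]] := @extract_increasing
  (fun i k => forall n, n \in iota 0 i -> `|L n - a k n| <= 2^-1 ^+ i)
  (fun i N => LP (iota 0 i) _ N (exprn_gt0 i h0)).
have aL n : (a (phi i) n : R^o) @[i --> \oo] --> (L n : R^o).
  apply/cvg_seqP => e e0; have [N NP] := half_pow_small e0.
  exists (maxn N n.+1) => i; rewrite geq_max => /andP[Ni ni].
  by apply: le_trans (NP i Ni); apply: phiP; rewrite mem_iota.
have L0 n : 0 <= L n by apply: cvgr_to_ge (aL n) _; exact: nearW.
have LS N : \sum_(0 <= n < N) L n <= s.
  have /cvgr_to_le := @cvg_finite_sum _ _ N aL; apply.
  by apply: nearW => i; exact: aS.
have [f fL] := series_hull_limit M0 uM L0 LS.
exists phi, f; split => //; first by exists L.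
apply/cvg_abs_weak_star_seqP => x x0; apply/cvg_seq0P => e e0.
(* d for the head, s + s times d for the tail *)
have s1 : 0 < s + s + 1 by rewrite ltr_wpDl// addr_ge0.
pose d := e / (s + s + 1); have d0 : 0 < d by rewrite divr_gt0.
have /cvg_seq0P/(_ _ d0)[N0 N0P] := u0 x.
pose T i := \sum_(0 <= n < N0) `|L n - a (phi i) n| * u n x.
have /cvg_seq0P/(_ _ d0)[N1 N1P] : (T i : R^o) @[i --> \oo] --> (0 : R^o).
  rewrite (_ : 0 = \sum_(0 <= n < N0) `|L n - L n| * u n x); last first.
    by rewrite big1// => n _; rewrite subrr normr0 mul0r.
  apply: cvg_finite_sum => n.
  apply: cvgMr_tmp; apply: (@cvg_norm _ R^o).
  by apply: cvgB; [exact: cvg_cst|exact: aL].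
exists N1 => i /N1P Ti.
rewrite ger0_norm; last exact: dual_ge0 (modulus_ge0 _) x0.
apply: dual_modulus_lub => // z xz zx.
have uz n : `|u n z| <= u n x by exact: pos_dual_bound.
have : (\sum_(0 <= n < N) a (phi i) n * u n z
    - \sum_(0 <= n < N) L n * u n z : R^o) @[N --> \oo]
    --> ((y (phi i) z : R^o) - (f z : R^o)).
  by apply: cvgB; [exact: ay|exact: fL].
move/cvgr_to_le; apply; exists N0 => // N /= N0N.
rewrite -sumrB.
apply: (@le_trans _ _ (\sum_(0 <= n < N) `|L n - a (phi i) n| * u n x)).
  apply: ler_sum => n _; rewrite -mulrBl.
  apply: (le_trans (ler_norm _)); rewrite normrM distrC.
  by rewrite ler_wpM2l.
rewrite (big_cat_nat (leq0n N0) N0N)//=.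
have -> : e = d + (s + s) * d by rewrite /d; field; rewrite gt_eqF.
apply: lerD; first exact: le_trans (ler_norm _) Ti.
apply: (@le_trans _ _ (\sum_(N0 <= n < N) (L n + a (phi i) n) * d)).
  apply: ler_sum_nat => n /andP[N0n _]; apply: ler_pM => //.
  - by apply: dual_ge0.
  - by apply: (le_trans (ler_normB _ _)); rewrite !ger0_norm.
  - exact: le_trans (ler_norm _) (N0P n N0n).
rewrite -mulr_suml ler_wpM2r ?(ltW d0)// big_split/=.
have tail (b : nat -> R) : (forall n, 0 <= b n) ->
    \sum_(0 <= n < N) b n <= s -> \sum_(N0 <= n < N) b n <= s.
  move=> b0; apply: le_trans.
  rewrite [leRHS](big_cat_nat (leq0n N0) N0N)//= lerDr.
  exact: sumr_ge0.
by apply: lerD; apply: tail.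
Qed.

(** Large multiples of small elements: the set contains 2^m w for every convex
    combination w of the u n of norm at most 4^-m. *)
Definition small_multiples u : set (dual E) :=
  [set y | exists m, series_hull u (2 ^+ m) y /\ `|y| <= 2^-1 ^+ m].

(** A sequence of this set either has infinitely many terms in one layer m,
    where series_hull_compact applies, or leaves every layer and is then norm
    null. *)
Lemma small_multiples_compact u : (forall n, 0 ⊑ u n) ->
  u @ \oo --> ((0 : dual E) : weak_star E) ->
  seq_abs_weak_star_compact (small_multiples u).
Proof.
move=> upos u0 y yK.
have [[m mP]|nm] := pselect (exists m, forall N, exists2 k, (N <= k)%N &
    series_hull u (2 ^+ m) (y k) /\ `|y k| <= 2^-1 ^+ m).
  have [phi [phi_inc phiP]] := @extract_increasing
    (fun _ k => series_hull u (2 ^+ m) (y k) /\ `|y k| <= 2^-1 ^+ m)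
    (fun _ => mP).
  have [psi [f [psi_inc fC yf]]] :=
    series_hull_compact (exprn_ge0 m (ler0n _ 2)) upos u0
      (fun i => (phiP i).1).
  exists (phi \o psi), f; split=> //.
    by move=> i j /=; rewrite phi_inc -leEnat psi_inc.
  exists m; split=> //.
  have yfx x : (y (phi (psi i)) x : R^o) @[i --> \oo] --> (f x : R^o).
    exact: (cvg_abs_weak_star_pointwise yf).
  have [g gf gm] := pointwise_limit_dual (fun i => (phiP (psi i)).2) yfx.
  by rewrite (_ : f = g)//; apply/val_inj/funext => x /=; rewrite gf.
exists id, 0; split=> //.
  exists 0%N; rewrite normr0 expr0; split=> //.
  exists (fun=> 0); split=> // [N|x]; first by rewrite big1.
  rewrite (_ : (fun N => _) = fun=> 0); first exact: cvg_cst.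
  by apply/funext => N; rewrite big1// => n _; rewrite mul0r.
apply: norm_null_abs_weak_star_null; apply/cvg_seq0P => e e0.
have [m0 m0P] := half_pow_small e0.
have /choice[B BP] m : exists N, forall k, (N <= k)%N ->
    ~ (series_hull u (2 ^+ m) (y k) /\ `|y k| <= 2^-1 ^+ m).
  apply: contrapT => nN; apply: nm; exists m => N; apply: contrapT => nk.
  by apply: nN; exists N => k Nk ky; apply: nk; exists k.
exists (\max_(m < m0) B m)%N => k Bk; have [m [ym ymle]] := yK k.
have [mm0|m0m] := ltnP m m0; last exact: le_trans ymle (m0P m m0m).
exfalso; apply: (BP m k); last by split.
exact: leq_trans (leq_bigmax (Ordinal mm0)) Bk.
Qed.

End SeriesHull.

(** * The gliding hump *)

Section GlidingHump.
Context {R : realType} {V : normedModType R}.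
Implicit Types (u v : nat -> dual V) (x : nat -> V).

(** S J is the sum of the first J of the differences z j = x (b j) - x (a j),
    chosen one after the other together with thresholds N j.  Taking a j and b j
    where the x n are close to a common cluster point, on the functionals of
    index below N j, makes z j nearly invisible to the earlier u n and v n; the
    next threshold N (j+1) is so large that S (j+1) is nearly invisible to the
    later ones.  Up to errors of total size at most d / 2, u (b i) then sees
    only z i, where it is at least d - d / 4; a given v k sees, up to a bounded
    error, at most one z j, whose norm is at most 2. *)
Lemma gliding_hump u v x (d M : R) :
  0 < d -> (forall n, `|x n| <= 1) -> (forall n, d <= u n (x n)) ->
  (forall z, (u n z : R^o) @[n --> \oo] --> (0 : R^o)) ->
  (forall z, (v n z : R^o) @[n --> \oo] --> (0 : R^o)) ->
  (forall n, `|v n| <= M) ->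
  exists (S : nat -> V) (b : nat -> nat) (C : R),
    [/\ forall J k, `|v k (S J)| <= C, forall i, (i <= b i)%N &
      forall i J, (i < J)%N -> d / 4 <= u (b i) (S J)].
Proof.
move=> d0 x1 ud u0 v0 vM.
have M0 : 0 <= M by exact: le_trans (vM 0%N).
have d4 : 0 < d / 4 by rewrite divr_gt0.
have [f|L LP] := @simultaneous_cluster_point R (dual V) (fun f j => f (x j)).
  exists `|f| => j; apply: (le_trans (dual_apply_le f (x j))).
  exact: ler_piMr (x1 j).
pose eps j := d / 4 * 2^-1 ^+ j.+1.
have eps0 j : 0 < eps j by rewrite mulr_gt0// exprn_gt0// invr_gt0.
(* h maps (j, S j, N j) to (z j, b j, N (j+1)) *)
have /choice[h hP] : forall s : nat * V * nat, exists t : V * nat * nat,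
  [/\ (s.2 <= t.1.2 < t.2)%N,
   forall k, (t.2 <= k)%N ->
     `|v k (s.1.2 + t.1.1)| <= 1 /\ `|u k (s.1.2 + t.1.1)| <= d / 4,
   forall n, (n < s.2)%N ->
     `|u n t.1.1| <= eps s.1.1 /\ `|v n t.1.1| <= eps s.1.1,
   `|t.1.1| <= 2 & d - d / 4 <= u t.1.2 t.1.1].
  move=> [[j S] N] /=.
  pose fs := [seq u n | n <- iota 0 N] ++ [seq v n | n <- iota 0 N].
  have e2 : 0 < eps j / 2 by rewrite divr_gt0.
  have [a Na aP] := LP fs _ N e2.
  have /cvg_seq0P/(_ _ d4)[N1 N1P] := u0 (x a).
  have [b Nb bP] := LP fs _ (maxn N N1) e2.
  move: Nb; rewrite geq_max => /andP[Nb N1b].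
  pose z := x b - x a.
  have /cvg_seq0P/(_ _ ltr01)[N2 N2P] := v0 (S + z).
  have /cvg_seq0P/(_ _ d4)[N3 N3P] := u0 (S + z).
  have fz f : f \in fs -> `|f z| <= eps j.
    move=> ff; rewrite linearB/= (splitr (eps j)) -(subrKA (L f)).
    apply: (le_trans (ler_normD _ _)); apply: lerD.
      by rewrite distrC; exact: bP.
    exact: aP.
  exists (z, b, (maxn b.+1 (maxn N2 N3)))%N => /=; split.
  - by rewrite Nb/= leq_max leqnn.
  - move=> k; rewrite !geq_max => /andP[_ /andP[N2k N3k]].
    by split; [exact: N2P|exact: N3P].
  - move=> n nN; split; apply: fz; rewrite mem_cat; apply/orP; [left|right];
      by apply: map_f; rewrite mem_iota.
  - by apply: (le_trans (ler_normB _ _)); rewrite (_ : 2 = 1 + 1)// lerD.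
  - rewrite linearB/= lerB//.
    by apply: (le_trans (ler_norm _)); exact: N1P.
pose fix st j : V * nat := if j is i.+1 then
    ((st i).1 + (h (i, (st i).1, (st i).2)).1.1, (h (i, (st i).1, (st i).2)).2)
  else (0, 0%N).
pose S j := (st j).1; pose N j := (st j).2.
pose z j := (h (j, S j, N j)).1.1; pose b j := (h (j, S j, N j)).1.2.
have SS j : S j.+1 = S j + z j by [].
have bN j : (N j <= b j < N j.+1)%N by have [] := hP (j, S j, N j).
have inv j k : (N j <= k)%N -> `|v k (S j)| <= 1 /\ `|u k (S j)| <= d / 4.
  case: j => [_|j]; last by have [_ + _ _ _] := hP (j, S j, N j); exact.
  by rewrite /S /= !linear0 !normr0 ler01 ltW.
have zsmall j n : (n < N j)%N -> `|u n (z j)| <= eps j /\ `|v n (z j)| <= eps j.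
  by have [_ _ + _ _] := hP (j, S j, N j); exact.
have z2 j : `|z j| <= 2 by have [] := hP (j, S j, N j).
have ubz j : d - d / 4 <= u (b j) (z j) by have [] := hP (j, S j, N j).
have Nge j : (j <= N j)%N.
  elim: j => // j IH; have /andP[h1 h2] := bN j.
  exact: leq_ltn_trans (leq_trans IH h1) h2.
(* acc j is the sum of the eps i for i < j *)
pose acc j := d / 4 * (1 - 2^-1 ^+ j).
have accS j : acc j.+1 = acc j + eps j by rewrite /acc /eps exprS; field.
have acc_le j : acc j <= d / 4.
  by rewrite ler_piMr ?ltW// gerBl exprn_ge0.
have acc_ge0 j : 0 <= acc j.
  by rewrite mulr_ge0 ?(ltW d4)// subr_ge0 exprn_ile1// invf_le1 ?ler1n.
exists S, b, (1 + M * 2 + d / 4); split.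
- move=> J k.
  (* 1 while N J <= k, M * 2 for the only step that crosses k *)
  suff : `|v k (S J)| <= 1 + M * 2 + acc J by move=> ?; have := acc_le J; lra.
  have [NJk|] := leqP (N J) k.
    have [vk _] := inv J k NJk; have := acc_ge0 J.
    by have : 0 <= M * 2 by [rewrite mulr_ge0]; lra.
  elim: J => // J IH kN; rewrite SS linearD/= accS.
  apply: (le_trans (ler_normD _ _)).
  have [NJk|kNJ] := leqP (N J) k.
    have [vk _] := inv J k NJk.
    have vz : `|v k (z J)| <= M * 2.
      by apply: (le_trans (dual_apply_le _ _)); rewrite ler_pM.
    by have := acc_ge0 J; have := eps0 J; lra.
  by have := IH kNJ; have [_] := zsmall J k kNJ; lra.
- by move=> i; have /andP[+ _] := bN i; apply: leq_trans.
- move=> i J iJ.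
  suff [] : (b i < N J)%N /\ d / 2 - acc J <= u (b i) (S J).
    by move=> _; have := acc_le J; lra.
  elim: J iJ => // J IH; rewrite ltnS leq_eqVlt => /predU1P[->|iJ].
    have /andP[Nb bN'] := bN J; split=> //.
    have [_] := inv J (b J) Nb; rewrite ler_norml => /andP[uS _].
    by have := ubz J; have := acc_ge0 J.+1; rewrite SS linearD/=; lra.
  have [bNJ uS] := IH iJ; split.
    by have /andP[h1 h2] := bN J; exact: ltn_trans (leq_trans bNJ h1) h2.
  have [+ _] := zsmall J (b i) bNJ; rewrite ler_norml => /andP[uz _].
  by rewrite SS linearD accS/=; lra.
Qed.

End GlidingHump.

(** * The three implications *)

Section MainImplications.
Context {R : realType} {E : banachLatticeType R}.

Lemma exists_apply_ge (V : normedModType R) (f : dual V) (e : R) :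
  e < `|f| -> exists2 x, `|x| <= 1 & e <= f x.
Proof.
move=> ef; apply: contrapT => nx; move: ef; apply/negP; rewrite -leNgt.
rewrite dual_normE; apply: op_norm_le => x x1.
have fe y : `|y| <= 1 -> f y <= e.
  move=> y1; rewrite leNgt; apply/negP => /ltW ey.
  by apply: nx; exists y.
rewrite ler_norml fe// andbT lerNl -linearN.
by apply: fe; rewrite normrN.
Qed.

Lemma closed_convex_hull_bounded_at (V : normedModType R) (v : nat -> dual V)
    (z : V) (C : R) (y : dual V) :
  (forall k, `|v k z| <= C) -> closed_convex_hull (range v) y -> `|y z| <= C.
Proof.
move=> vC /closed_convex_hullP yv.
apply/ler_addgt0Pl => e e0.
have d0 : 0 < e / (`|z| + 1) by rewrite divr_gt0// ltr_wpDl.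
have [w wv yw] := yv _ d0.
have wC : `|w z| <= C.
  apply: (@convex_hull_sub _ _ (range v) [set w : dual V | `|w z| <= C]) wv.
    by move=> _ [k _ <-]; exact: vC.
  move=> f g t t0 t1 /= fC gC.
  rewrite -[X in `|X|]/(t * f z + (1 - t) * g z).
  have t1' : 0 <= 1 - t by rewrite subr_ge0.
  apply: (le_trans (ler_normD _ _)).
  rewrite !normrM (ger0_norm t0) (ger0_norm t1').
  by have := ler_wpM2l t0 fC; have := ler_wpM2l t1' gC; lra.
rewrite -[y z](subrK (w z)); apply: (le_trans (ler_normD _ _)).
apply: lerD => //; apply: (le_trans (dual_apply_le (y - w) z)).
apply: (@le_trans _ _ (e / (`|z| + 1) * (`|z| + 1))).
  by apply: ler_pM => //; rewrite lerDl.
by rewrite divfK// gt_eqF// ltr_wpDl.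
Qed.

Lemma positive_Schur_abs_weak_star_null : dual_positive_Schur E ->
  forall u : nat -> dual E, abs_weak_star_null u -> u @ \oo --> (0 : dual E).
Proof.
move=> schur u u0; apply/cvg_seq0P => e e0.
have /cvg_seq0P/(_ _ e0)[N NP] :=
  schur _ (fun n => modulus_ge0 (u n)) (abs_weak_star_null_modulus u0).
by exists N => n /NP; apply: le_trans; exact: norm_dual_modulus.
Qed.

Lemma abs_weak_star_null_compact_hull :
  (forall u : nat -> dual E,
    abs_weak_star_null u -> u @ \oo --> (0 : dual E)) ->
  positive_Grothendieck E /\
  forall K : set (dual E), seq_abs_weak_star_compact K ->
    exists u : nat -> dual E,
      abs_weak_star_null u /\ K `<=` closed_convex_hull (range u).
Proof.
move=> nullE; split=> [u upos u0|K cK].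
  have /nullE/cvg_seq0P un := abs_weak_star_null_pos upos u0.
  apply/cvg_weakP => f; rewrite linear0; apply/cvg_seq0P => e e0.
  have d0 : 0 < e / (`|f| + 1) by rewrite divr_gt0// ltr_wpDl.
  have [N NP] := un _ d0; exists N => n /NP unN.
  apply: (le_trans (dual_apply_le f (u n))).
  apply: (@le_trans _ _ ((`|f| + 1) * (e / (`|f| + 1)))).
    by apply: ler_pM => //; rewrite lerDl.
  by rewrite mulrC divfK// gt_eqF// ltr_wpDl.
have [u [u0 Ku]] : exists u : nat -> dual E,
    u @ \oo --> (0 : dual E) /\ K `<=` closed_convex_hull (range u).
  apply: totally_bounded_sub_null_hull; apply: seq_compact_net => u Ku.
  have [phi [f [phi_inc _ uf]]] := cK u Ku.
  exists phi, f; split=> //; apply/cvg_seqP => e e0.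
  have /nullE/cvg_seq0P/(_ _ e0)[N NP] :
      abs_weak_star_null (fun n => u (phi n) - f).
    by apply/abs_weak_star_nullP; exact/cvg_abs_weak_star_seqP.
  by exists N => n /NP; rewrite distrC.
by exists u; split=> //; exact: norm_null_abs_weak_star_null.
Qed.

Lemma compact_hull_positive_Schur : positive_Grothendieck E ->
  (forall K : set (dual E), seq_abs_weak_star_compact K ->
    exists u : nat -> dual E,
      abs_weak_star_null u /\ K `<=` closed_convex_hull (range u)) ->
  dual_positive_Schur E.
Proof.
move=> groth hulls u0 u0pos u0null; apply: contrapT => /cvg_seq0P.
move=> /existsNP[d /not_implyP[d0 nN]].
have [phi [phi_inc ud]] : exists phi, increasing_seq phi /\
    forall i, d < `|u0 (phi i)|.
  apply: (@extract_increasing (fun _ j => d < `|u0 j|)) => _ N.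
  apply: contrapT => nj; apply: nN; exists N => n Nn.
  by rewrite leNgt; apply/negP => dn; apply: nj; exists n.
pose u := u0 \o phi.
have upos n : 0 ⊑ u n by exact: u0pos.
have unull : u @ \oo --> ((0 : dual E) : weak_star E).
  move/weak_star_nullP : u0null => u0z; apply/weak_star_nullP => z.
  exact: (cvg_subseq phi_inc (u0z z)).
have /choice[x xP] : forall n, exists x, `|x| <= 1 /\ d <= u n x.
  by move=> n; have [x x1 dx] := exists_apply_ge (ud n); exists x.
have /weak_star_nullP uz := unull.
have [v [vnull Kv]] := hulls _ (small_multiples_compact upos unull).
have v0 := cvg_abs_weak_star_pointwise vnull.
have [M M0 vM] := weak_star_null_bounded v0.
have [S [b [C [vS bge ubS]]]] := gliding_hump d0 (fun n => (xP n).1)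
  (fun n => (xP n).2) uz v0 vM.
have /cvg_weakP uweak := groth _ upos unull.
have ubweak (f : dual (dual E)) :
    (f (u (b n)) : R^o) @[n --> \oo] --> (0 : R^o).
  apply/cvg_seq0P => e e0; have := uweak f.
  rewrite linear0 => /cvg_seq0P/(_ _ e0)[N NP].
  by exists N => n Nn; apply: NP; exact: leq_trans (bge n).
have C0 : 0 <= C by exact: le_trans (vS 0%N 0%N).
(* m is such that 2^m (d / 4) exceeds C *)
have d4 : 0 < d / 4 / (C + 1) by rewrite !divr_gt0// ltr_wpDl.
have [m /(_ m (leqnn m)) mP] := half_pow_small d4.
have h0 : 0 < 2^-1 ^+ m :> R by rewrite exprn_gt0// invr_gt0.
have [w wub wsmall] := Mazur ubweak (mulr_gt0 h0 h0).
have [J0 wS] : exists J0, forall J, (J0 <= J)%N -> d / 4 <= w (S J).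
  apply: (@convex_hull_sub _ _ (range (u \o b))
    [set w : dual E |
      exists J0, forall J, (J0 <= J)%N -> d / 4 <= w (S J)]) wub.
    by move=> _ [i _ <-]; exists i.+1 => J; exact: ubS.
  move=> f g t t0 t1 [Jf fS] [Jg gS]; exists (maxn Jf Jg) => J.
  rewrite geq_max => /andP[/fS {}fS /gS {}gS].
  rewrite -[leRHS]/(t * f (S J) + (1 - t) * g (S J)).
  have t1' : 0 <= 1 - t by rewrite subr_ge0.
  by have := ler_wpM2l t0 fS; have := ler_wpM2l t1' gS; lra.
have wC : series_hull u 1 w.
  apply: (@convex_hull_sub _ _ (range (u \o b)) (series_hull u 1)) wub.
    by move=> _ [i _ <-]; exact: mem_series_hull.
  by move=> *; exact: series_hull_convex.
have p0 : 0 < 2 ^+ m :> R by rewrite exprn_gt0.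
have wK : small_multiples u (2 ^+ m *: w).
  exists m; split.
    rewrite -[X in series_hull _ X]mulr1.
    by apply: series_hull_scale; rewrite ?ltW.
  rewrite normrZ gtr0_norm//; apply: (le_trans (ler_wpM2l (ltW p0) wsmall)).
  by rewrite mulrA -exprMn mulfV// expr1n mul1r.
have := closed_convex_hull_bounded_at (fun k => vS J0 k) (Kv _ wK).
apply/negP; rewrite -ltNge; apply: lt_le_trans (ler_norm _).
rewrite -[ltRHS]/(2 ^+ m * w (S J0)).
apply: (@lt_le_trans _ _ (2 ^+ m * (d / 4))); last first.
  by rewrite ler_wpM2l ?(ltW p0)// wS.
move: mP; rewrite ler_pdivlMr ?ltr_wpDl// exprVn ler_pdivrMl//.
by apply: lt_le_trans; rewrite ltrDl.
Qed.

End MainImplications.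

Unset Implicit Arguments.
Set Strict Implicit.

Theorem corollary3p6 (R : realType) (E : banachLatticeType R) :
  [<-> (* (a) *) dual_positive_Schur E ;
       (* (b) *) forall u : nat -> dual E,
                   abs_weak_star_null u -> u @ \oo --> (0 : dual E) ;
       (* (c) *) positive_Grothendieck E /\
                 forall K : set (dual E), seq_abs_weak_star_compact K ->
                   exists u : nat -> dual E,
                     abs_weak_star_null u /\
                     K `<=` closed_convex_hull (range u) ].
Proof.
tfae.
- exact: positive_Schur_abs_weak_star_null.
- exact: abs_weak_star_null_compact_hull.
- by move=> [groth hulls]; exact: compact_hull_positive_Schur.
Qed.
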